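(* Let $\mathcal{B}\subseteq\mathsf{SVW}_{n,m}$ be a full subcrystal. Then $S\mapsto(P_{\mathsf{hecke}}(S),Q_{\mathsf{hecke}}(S))$ is a bijection from $\mathcal{B}$ to the set of pairs of tableaux $(P,Q)$ of the same shape such that (a) $P$ is an increasing tableau and $P=\mathsf{tab}(S)$ for some highest weight element $S\in\mathcal{B}$, and (b) $Q$ is a semistandard set-valued tableau with all entries contained in $[n]$.
   Context: $[n]=\{1,\dots,n\}$, $\mathbf{e}_k$ standard basis of $\mathbb{Z}^n$. For $T\subseteq[n]$ (possibly empty), $\mathrm{wt}(T)=\sum_{j\in T}\mathbf{e}_j$, and for $i\in[n-1]$: $e_i(T)=T\cup\{i\}$ if $T\cap\{i,i+1\}=\{i+1\}$, $T\setminus\{i+1\}$ if $T\cap\{i,i+1\}=\{i,i+1\}$, else $0$; $f_i(T)=T\cup\{i+1\}$ if $T\cap\{i,i+1\}=\{i\}$, $T\setminus\{i\}$ if $T\cap\{i,i+1\}=\{i,i+1\}$, else $0$. With $\varepsilon_i(b)=\sup\{k:e_i^k(b)\ne0\}$, $\varphi_i(b)=\sup\{k:f_i^k(b)\ne0\}$, tensor products have additive weights, $e_i(b\otimes c)=b\otimes e_i(c)$ if $\varepsilon_i(b)\le\varphi_i(c)$ else $e_i(b)\otimes c$, $f_i(b\otimes c)=b\otimes f_i(c)$ if $\varepsilon_i(b)<\varphi_i(c)$ else $f_i(b)\otimes c$, $b\otimes0=0\otimes c=0$. $\mathsf{SVW}_{n,m}$ is the set of $m$-tuples $S=(S_1,\dots,S_m)$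 of subsets of $[n]$, a crystal via $S\leftrightarrow S_1\otimes\cdots\otimes S_m$. A full subcrystal is the vertex set of a weakly connected component of the graph with edges $S\to f_i(S)\neq 0$; highest weight means $e_i(S)=0$ for all $i$. $\mathsf{tab}(S)$ is the left-justified tableau (matrix coordinates) whose row $i$ lists $m+1-j$, over $j$ with $i\in S_j$, increasingly. An increasing tableau has Young-diagram shape with strictly increasing rows and columns. A semistandard set-valued tableau of a Young-diagram shape fills each box with a nonempty set of positive integers such that every choice of one element per box gives weakly increasing rows and strictly increasing columns. Hecke insertion of $x$ into an increasing tableau $T$: process columns from the first. In a column, let $y$ be the smallest entry with $x<y$. If no such $y$ exists: if appending $x$ at the bottom of the column gives an increasing tableau, do so and say the insertion ends at this new box; otherwise leave the tableau unchanged and, if the last box of the column is in row $r$ and the last box of row $r$ is in column $c$, say the insertion ends at $(r,c)$; stop. If $y$ exists, replace $y$ by $x$ if the result is increasing (else leave unchanged), and insert the bumped $y$ into the next column in the same way. For $i\in[n]$ let $j_1<\dots<j_k$ be the indices $j$ with $i\in S_j$, $A_i=(m+1-j_1)\cdots(m+1-j_k)$ and $I_i=i\,i\cdots i$ ($k$ copies); $A(S)=A_1\cdots A_n=A(S)_1\cdots A(S)_L$ and $I(S)=I_1\cdots I_n=I(S)_1\cdots I(S)_L$. Set $P_0=Q_0=\emptyset$; $P_k$ is the Hecke insertion of $A(S)_k$ into $P_{k-1}$, and $Q_k$ is the set-valued tableau of the same shape as $P_k$ obtained from $Q_{k-1}$ by adding $I(S)_k$ to the (possibly new) box where this insertion ends.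 $P_{\mathsf{hecke}}(S)=P_L$, $Q_{\mathsf{hecke}}(S)=Q_L$. *)

(* Defs.v *)
From mathcomp Require Import all_boot.

Set Implicit Arguments.
Unset Strict Implicit.
Unset Printing Implicit Defensive.

(* Indices start from 0: i : 'I_n stands for the letter i + 1 of [n],
   j : 'I_m for the position j + 1, and i : 'I_n.-1 for the index i + 1 of
   [n - 1].  The entry m + 1 - j attached to a position is therefore m - j. *)

(** * Crystal operators *)

(* [None] plays the role of 0. *)
Record crystal (I : Type) (V : finType) := Crystal {
  cry_e : I -> V -> option V;
  cry_f : I -> V -> option V
}.

(* sup {k : g^k(x) <> 0}.  If this supremum is finite then the iterates
   x, g(x), g^2(x), ... are distinct until they vanish, so that it is attained
   at some k < #|V|. *)
Definition string_length (V : finType) (g : V -> option V) (x : V) : nat :=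
  \max_(k < #|V| | iter k (obind g) (Some x) != None) k.

Definition cry_eps I (V : finType) (C : crystal I V) (i : I) (x : V) : nat :=
  string_length (cry_e C i) x.

Definition cry_phi I (V : finType) (C : crystal I V) (i : I) (x : V) : nat :=
  string_length (cry_f C i) x.

Definition tensor I (V W : finType) (C : crystal I V) (D : crystal I W) :
    crystal I (V * W)%type :=
  {| cry_e := fun i x =>
       if cry_eps C i x.1 <= cry_phi D i x.2
       then omap (fun c => (x.1, c)) (cry_e D i x.2)
       else omap (fun b => (b, x.2)) (cry_e C i x.1);
     cry_f := fun i x =>
       if cry_eps C i x.1 < cry_phi D i x.2
       then omap (fun c => (x.1, c)) (cry_f D i x.2)
       else omap (fun b => (b, x.2)) (cry_f C i x.1) |}.

Definition transport I (V W : finType) (h : V -> W) (h' : W -> V)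
    (C : crystal I V) : crystal I W :=
  {| cry_e := fun i x => omap h (cry_e C i (h' x));
     cry_f := fun i x => omap h (cry_f C i (h' x)) |}.

Lemma next_ord_subproof n (i : 'I_n.-1) : i.+1 < n.
Proof. by case: n i => [[]|n i] //=; rewrite ltnS. Qed.

Definition this_ord n (i : 'I_n.-1) : 'I_n := widen_ord (leq_pred n) i.
Definition next_ord n (i : 'I_n.-1) : 'I_n := Ordinal (next_ord_subproof i).

Definition set_crystal n : crystal 'I_n.-1 {set 'I_n} :=
  {| cry_e := fun i T =>
       let a := this_ord i in let b := next_ord i in
       if T :&: [set a; b] == [set b] then Some (a |: T)
       else if T :&: [set a; b] == [set a; b] then Some (T :\ b)
       else None;
     cry_f := fun i T =>
       let a := this_ord i in let b := next_ord i in
       if T :&: [set a; b] == [set a] then Some (b |: T)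
       else if T :&: [set a; b] == [set a; b] then Some (T :\ a)
       else None |}.

Notation SVW n m := (m.-tuple {set 'I_n}).

(* The empty tensor product is the one-element crystal with zero operators,
   a unit for [tensor]. *)
Fixpoint svw_crystal n m : crystal 'I_n.-1 (SVW n m) :=
  if m is m'.+1 then
    transport (fun x : {set 'I_n} * SVW n m' => cons_tuple x.1 x.2)
              (fun S : SVW n m'.+1 => (thead S, behead_tuple S))
              (tensor (set_crystal n) (svw_crystal n m'))
  else {| cry_e := fun _ _ => None; cry_f := fun _ _ => None |}.

Definition crystal_edge n m : rel (SVW n m) :=
  fun S T => [exists i, cry_f (svw_crystal n m) i S == Some T].

Definition weakly_connected n m : rel (SVW n m) :=
  connect (fun S T => crystal_edge S T || crystal_edge T S).

Definition full_subcrystal n m (B : {set SVW n m}) : Prop :=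
  exists S : SVW n m, B = [set T | weakly_connected S T].

Definition highest_weight n m (S : SVW n m) : Prop :=
  forall i, cry_e (svw_crystal n m) i S = None.

(** * Tableaux *)

(* A tableau is the list of its rows, without trailing empty rows; its shape is
   the library's [shape]. *)
Definition tableau (A : Type) := seq (seq A).

Definition column A (T : tableau A) (c : nat) : seq A :=
  pmap (fun row => onth row c) T.

Definition columns A (T : tableau A) : seq (seq A) :=
  mkseq (column T) (size (head [::] T)).

Definition set_box A (x0 : A) (T : tableau A) (r c : nat) (x : A) : tableau A :=
  set_nth [::] T r (set_nth x0 (nth [::] T r) c x).

Definition young_diagram (s : seq nat) : bool := sorted geq s && (0 \notin s).

Definition increasing (T : tableau nat) : bool :=
  [&& young_diagram (shape T), all (sorted ltn) T & all (sorted ltn) (columns T)].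

Definition semistandard n (T : tableau 'I_n) : bool :=
  [&& young_diagram (shape T),
      all (sorted (fun x y : 'I_n => x <= y)) T &
      all (sorted (fun x y : 'I_n => x < y)) (columns T)].

Definition svtableau n := tableau {set 'I_n}.

(* t selects one element from each box of Q *)
Definition choice_of n (t : tableau 'I_n) (Q : svtableau n) : bool :=
  all2 (all2 (fun (x : 'I_n) (X : {set 'I_n}) => x \in X)) t Q.

Definition semistandard_sv n (Q : svtableau n) : Prop :=
  [/\ young_diagram (shape Q),
      all (all (fun X : {set 'I_n} => X != set0)) Q &
      forall t : tableau 'I_n, choice_of t Q -> semistandard t].

(** * Hecke insertion *)

(* Inserts x into the columns of T from column c on, and returns the new
   tableau with the box where the insertion ends.  [fuel] bounds the number of
   columns visited.  Columns are increasing, so the first entry y with x < y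
   is the smallest one.  The test on [size (nth [::] T k)] rejects appending
   x at the bottom of column c when the new box (k, c) would not be adjacent
   to row k; [set_box] would pad that row with zeros. *)
Fixpoint hecke_from (fuel : nat) (T : tableau nat) (c x : nat) :
    tableau nat * (nat * nat) :=
  if fuel is fuel'.+1 then
    let col := column T c in
    let k := find (ltn x) col in
    let T' := set_box 0 T k c x in
    if k < size col then
      hecke_from fuel' (if increasing T' then T' else T) c.+1 (nth 0 col k)
    else if (size (nth [::] T k) == c) && increasing T' then (T', (k, c))
    else let r := (size col).-1 in (T, (r, (size (nth [::] T r)).-1))
  else (T, (0, c)).

(* The insertion stops at the latest in the first empty column. *)
Definition hecke_insert (T : tableau nat) (x : nat) :
    tableau nat * (nat * nat) :=
  hecke_from (size (head [::] T)).+1 T 0 x.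

Definition A_word_at n m (S : SVW n m) (i : 'I_n) : seq nat :=
  [seq m - nat_of_ord j | j <- enum 'I_m & i \in tnth S j].

Definition A_word n m (S : SVW n m) : seq nat :=
  flatten [seq A_word_at S i | i <- enum 'I_n].

Definition I_word n m (S : SVW n m) : seq 'I_n :=
  flatten [seq nseq (size (A_word_at S i)) i | i <- enum 'I_n].

Definition hecke_step n (PQ : tableau nat * svtableau n) (ai : nat * 'I_n) :
    tableau nat * svtableau n :=
  let: (P', (r, c)) := hecke_insert PQ.1 ai.1 in
  (P', set_box set0 PQ.2 r c (ai.2 |: nth set0 (nth [::] PQ.2 r) c)).

Definition hecke n m (S : SVW n m) : tableau nat * svtableau n :=
  foldl (@hecke_step n) ([::], [::]) (zip (A_word S) (I_word S)).

Definition P_hecke n m (S : SVW n m) : tableau nat := (hecke S).1.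
Definition Q_hecke n m (S : SVW n m) : svtableau n := (hecke S).2.

(** * The tableau of a set-valued word *)

Definition trim_rows A (T : tableau A) : tableau A :=
  foldr (fun row T' => if nilp row && nilp T' then [::] else row :: T') [::] T.

Definition tab n m (S : SVW n m) : tableau nat :=
  trim_rows [seq rev (A_word_at S i) | i <- enum 'I_n].

(* Main.v *)
(**
Write T|v for the part of a tableau T with entries below v.  Let R be an
increasing tableau with k rows and let A be the next row of the word.  On every
T|v, inserting the letters of A acts on shapes only: each letter adds a box or
ends at a corner, and passing from v to v + 1 is governed by a local rule.
Collecting all letters of A, this local rule is exactly the signature rule for
applying e_{k}^max, ..., e_1^max successively to the rows (R, A).  Hence

- the word of S is joined in the crystal, row by row, to the word S' with
  tab S' = P_hecke S, and S' is a highest weight element because its tableau is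
  increasing;
- the local rule is invertible, and the labels of Q record the final value of
  phi for each of these sweeps, so S can be recovered from (P, Q), and every
  (P, Q) occurs.

So S |-> (P, Q) is a bijection on all of SVW, and the component of S contains
the unique S' with tab S' = P.
*)

Require Import Defs.
From mathcomp Require Import all_boot zify.
From mathcomp Require Import mathcomp_extra boolp classical_sets functions.

Set Implicit Arguments.
Unset Strict Implicit.
Unset Printing Implicit Defensive.

(** * Local rules *)

(** Hecke insertion may absorb a letter without changing the tableau, so the shapes before and after
    ([mu], [la]) do not show what was inserted. The third family [u] carries the missing count, and
    it has two readings at once: it adds up the insertions by the row in which they end, hence fixes
    the boxes of Q that receive the new label; and [u i] counts the letters of the moving row once
    the sweep has brought it to position i, from the inserted row at the bottom to [u 0 = la 0] at
    the top. The formula for phi behind [sig_step] comes from the shape of the strings: on a single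
    set phi_i - eps_i is twice the number of letters i minus the number of letters i + 1, and this
    is additive under tensor products. Let x, y be the two counts before e_i^max and p, q those
    after it. Then phi - eps = 2(x - y), while phi + eps = 2(p - q) because eps is 0 at the end;
    hence phi = x + p - (y + q). A bump is visible only between the levels v and v + 1, where v is
    the bumped letter, so columns need not be followed explicitly. The letters of a row arrive in
    decreasing order, so each one starts at levels not yet touched by its predecessors. *)

Definition unit_steps (f f1 : nat -> nat) := forall i, f i <= f1 i /\ f1 i <= (f i).+1.

(** The boxes of an increasing tableau that hold one given value form such a strip: no two of them
    share a row or a column. *)
Definition rook_strip (f f1 : nat -> nat) :=
  unit_steps f f1 /\ forall i, f1 i.+1 <= f i.

(* [mu] and [la] are the row lengths before and after inserting a row, and
   [u i = la i + sum_(j < i) n j] where [n j] insertions ended in row [j].  The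
   second half says that [n i] exceeds [la i - mu i] by 0 or 1, and by 1 only if
   the box at the end of row [i] of [mu] is still a corner of [la]. *)
Definition hstrip (mu la u : nat -> nat) :=
  u 0 = la 0 /\
  forall i, [/\ la i.+1 <= mu i, mu i <= la i,
    la i.+1 + u i <= mu i + u i.+1, mu i + u i.+1 <= (la i.+1 + u i).+1 &
    mu i <= la i.+1 -> mu i + u i.+1 <= la i.+1 + u i].

(* [x], [y] (resp. [p], [q]) count the letters below v in rows i, i + 1 of a word
   before (resp. after) e_i^max, and [x1], ... count those up to v.  On the part
   of the word below v, phi_i is [x + p - (y + q)]. *)
Definition sig_step (x y p q x1 y1 p1 q1 : nat) : Prop :=
  [\/ [/\ y1 = y, p1 + x = x1 + p & q1 = q],
      [/\ y1 = y.+1, x + p = y + q, p1 = p.+1 & q1 = q],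
      [/\ y1 = y.+1, x + p = (y + q).+1, p1 = p.+1 & q1 = q.+1] |
      [/\ y1 = y.+1, (y + q).+1 < x + p, p1 + x = x1 + p & q1 = q.+1]].

Definition level_step (mu la u mu1 la1 u1 : nat -> nat) :=
  unit_steps u u1 /\
  forall i, sig_step (mu i) (u i.+1) (u i) (la i.+1)
                     (mu1 i) (u1 i.+1) (u1 i) (la1 i.+1).

(* Inserting a letter changes the shape at a level by an event [(k, g)]: if [g],
   a box is added to row [k]; otherwise the insertion ends in row [k - 1] and the
   shape is unchanged.  In both cases [u i] grows by one exactly for [k <= i]. *)
Definition event_la (la : nat -> nat) (k : nat) (g : bool) i :=
  la i + (g && (i == k)).

Definition event_u (u : nat -> nat) (k : nat) i := u i + (k <= i).

Definition legal (mu la u : nat -> nat) (k : nat) (g : bool) :=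
  [/\ forall i, i < k -> mu i = la i, forall i, i <= k -> u i = la i,
      0 < k -> la k < mu k.-1 & g || (0 < k)].

(* [la], [la1] are the row lengths at levels v and v + 1.  The entries of column
   [C] that are at most v occupy the rows 0, ..., [k] - 1, and [g] tells whether v
   can be placed in the box [(k, C)]: the entry above must be smaller than v, and
   [lf] says the same about the entry on the left. *)
Definition enters (la la1 : nat -> nat) (C : nat) (lf : bool) k (g : bool) :=
  (forall j, (C < la1 j) = (j < k)) /\
  g = lf && ((k == 0) || (C < la k.-1)).

(* At level v the inserted letter sits in, or was rejected from, the box
   [(k, la k)].  If v is the entry of this box it is bumped to the next column; if
   it was not replaced and stays in row [k], it is its own left neighbour. *)
Definition event_step (la la1 : nat -> nat) k (g : bool) k1 (g1 : bool) :=
  if la1 k == la k then k1 = k /\ g1 = g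
  else enters la la1 (la k).+1 (g || (k1 < k)) k1 g1.

(** * Effect of a single letter on consecutive levels *)

Lemma hstrip_event mu la u k g :
  hstrip mu la u -> legal mu la u k g ->
  hstrip mu (event_la la k g) (event_u u k).
Proof.
move=> [h0 h] [l1 l2 l3 l4]; rewrite /event_la /event_u; split.
  by case: k l1 l2 l3 l4 => [|k] l1 l2 l3 l4; have := l2 0; lia.
move=> i; have [h1 h2 h3 h4 h5] := h i.
case: (ltngtP i.+1 k) => [lt|gt|eq].
- have := l1 i; have := l1 i.+1; have := l2 i.+1; have := l2 i.
  split; lia.
- case: (ltngtP i k) => [lt2|gt2|eq2]; [lia|split; lia|].
  subst i; have := l2 k; have := l2 k.+1; split; lia.
- subst k; have := l1 i; have := l2 i; have := l2 i.+1; simpl in l3.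
  split; lia.
Qed.

(** Above row k the three functions agree, so phi is the even number 2([la i] - [la i.+1]) there. It
    is at least 2 for i = k - 1 by the last hypothesis, and for smaller i, by descending induction
    and the strip condition on [mu], whenever the count in row i + 1 grows. The exceptional cases
    phi = 0 and phi = 1 of [sig_step] are thus excluded, and the functions keep growing in
    parallel. *)
Lemma sig_below mu la u mu1 la1 u1 k :
  rook_strip mu mu1 -> rook_strip la la1 ->
  hstrip mu la u -> hstrip mu1 la1 u1 -> level_step mu la u mu1 la1 u1 ->
  (forall i, i < k -> mu i = la i) -> (forall i, i <= k -> u i = la i) ->
  (0 < k -> la k < mu k.-1) ->
  forall i, i < k -> mu1 i = la1 i /\ u1 i = la1 i.
Proof.
move=> [rm1 rm2] [rl1 rl2] [h0 h] [h10 h1] [iu st] l1 l2 l3.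
have keyu i : i < k -> u1 i + mu i = mu1 i + u i.
  move=> ik; have [j e] : exists j, i + j.+1 = k by exists (k - i.+1); lia.
  clear ik; elim: j i e => [|j IH] i e.
    have e2 : k = i.+1 by lia.
    have := l3 ltac:(lia); rewrite e2 /=.
    have := l2 i.+1 ltac:(lia); have := l2 i ltac:(lia); have := l1 i ltac:(lia).
    by case: (st i) => -[]; lia.
  have := IH i.+1 ltac:(lia); have := l2 i.+1 ltac:(lia); have := l2 i ltac:(lia).
  have := l1 i ltac:(lia); have := l1 i.+1 ltac:(lia); have := rm2 i.
  by case: (st i) => -[]; lia.
case=> [|i] ik.
  by have := keyu 0 ik; have := l1 0 ik; have := l2 0; lia.
have := keyu i.+1 ik; have := keyu i ltac:(lia).
have := l1 i.+1 ik; have := l1 i ltac:(lia); have := rm2 i.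
have := l2 i ltac:(lia); have := l2 i.+1 ltac:(lia).
by case: (st i) => -[]; lia.
Qed.

(** This is the rule that bumping paths move weakly upwards: row k has at most [(la k).+1] entries
    up to v, so none of them lies in the next column, and the bumped letter lands in row k or
    above. *)
Lemma event_step_legal mu la u mu1 la1 u1 k g k1 g1 :
  rook_strip mu mu1 -> rook_strip la la1 ->
  hstrip mu la u -> hstrip mu1 la1 u1 -> level_step mu la u mu1 la1 u1 ->
  legal mu la u k g -> event_step la la1 k g k1 g1 ->
  k1 <= k /\ legal mu1 la1 u1 k1 g1.
Proof.
move=> rm rl hs hs1 ls [l1 l2 l3 l4] ev.
have bel := sig_below rm rl hs hs1 ls l1 l2 l3.
case: rm rl hs hs1 ls => rm1 rm2 [rl1 rl2] [h0 h] [h10 h1] [iu st].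
have uk : u1 k = la1 k.
  case: k l1 l2 l3 {l4 ev} bel => [|k] l1 l2 l3 bel; first by lia.
  have := l2 k ltac:(lia); have := l2 k.+1 ltac:(lia).
  have := l1 k ltac:(lia); have /= := l3 ltac:(lia).
  by case: (st k) => -[]; lia.
have k1k : k1 <= k.
  move: ev; rewrite /event_step; case: eqP => [_ [-> _]|_ [ent _]] //.
  by have := ent k; have := rl1 k; lia.
split=> //; split.
- by move=> i ik; case: (bel i ltac:(lia)).
- move=> i ik; case: (ltngtP i k) => [lt|gt|eq]; [by case: (bel i lt)|lia|by subst].
- move: ev; rewrite /event_step; case: eqP => [lak [-> _] k0|lak [ent _] k0].
    by rewrite lak; have := l3 k0; have := rm1 k.-1; lia.
  have [-> _] := bel k1.-1 ltac:(lia).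
  have := ent k1; have := ent k1.-1; lia.
- move: ev; rewrite /event_step; case: eqP => [lak [-> ->]|lak [ent ->]] //.
  case: (posnP k1) => [k10|]; last by rewrite orbT.
  by rewrite k10 /= andbT orbF; lia.
Qed.

(** For row pairs with k <= i, both [u i] and [u i.+1] grow by one at both levels, so phi and the
    case of [sig_step] are unchanged. Pairs with i + 1 < k1 are not touched at all. Only the pairs
    within rows k1 - 1 to k can change case. *)
Lemma event_step_sig mu la u mu1 la1 u1 k g k1 g1 :
  rook_strip mu mu1 -> rook_strip la la1 ->
  hstrip mu la u -> hstrip mu1 la1 u1 -> level_step mu la u mu1 la1 u1 ->
  legal mu la u k g -> event_step la la1 k g k1 g1 ->
  level_step mu (event_la la k g) (event_u u k)
             mu1 (event_la la1 k1 g1) (event_u u1 k1).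
Proof.
move=> rm rl hs hs1 ls lg ev.
have [k1k [m1 m2 m3 m4]] := event_step_legal rm rl hs hs1 ls lg ev.
case: lg => l1 l2 l3 l4.
have bel := sig_below rm rl hs hs1 ls l1 l2 l3.
case: rm rl hs hs1 ls => rm1 rm2 [rl1 rl2] [h0 h] [h10 h1] [iu st].
have mono j d : la (j + d) <= la j.
  elim: d => [|d IH]; rewrite ?addn0 // addnS.
  by have [] := h (j + d); lia.
(* These rows reach beyond column [la k] by legality, but have no entry up to v in column
   [(la k).+1]; this pins their length at both levels. *)
have klow i : k1 <= i -> i < k -> la i = (la k).+1 /\ la1 i = (la k).+1.
  move=> k1i ik; move: ev; rewrite /event_step; case: eqP => [lak [k1e _]|lak [ent _]].
    by lia.
  have := ent i; have := rl1 i; have := mono i (k.-1 - i).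
  have -> : i + (k.-1 - i) = k.-1 by lia.
  have := l3 ltac:(lia); have := l1 k.-1; lia.
split.
  move=> i; rewrite /event_u; have := iu i.
  case: (ltnP i k) => ik; last by lia.
  case: (leqP k1 i) => k1i; last by lia.
  have [a b] := klow i k1i ik; have := l2 i; have := bel i ik; lia.
move=> i; rewrite /event_u /event_la.
case: (ltngtP k i.+1) => [lt|gt|eq].
- have -> : (i.+1 == k1) = false by lia.
  have -> : k <= i by lia.
  have -> : k1 <= i.+1 by lia.
  have -> : k1 <= i by lia.
  rewrite ?andbF ?addn0 ?addn1.
  by case: (st i) => -[*];
    [apply: Or41|apply: Or42|apply: Or43|apply: Or44]; split; lia.
- have [b1 b2] := bel i ltac:(lia); have [b3 b4] := bel i.+1 ltac:(lia).
  have a1 := l1 i ltac:(lia); have a2 := l1 i.+1 ltac:(lia).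
  have a3 := l2 i ltac:(lia); have a4 := l2 i.+1 ltac:(lia).
  have r1 := rm1 i; have r2 := rm1 i.+1; have r3 := rm2 i.
  have kl1 := klow i; have kl2 := klow i.+1.
  have -> : (k <= i) = false by lia.
  rewrite ?andbF ?addn0.
  case: (ltngtP k1 i.+1) => [lt1|gt1|eq1].
  + have -> : k1 <= i by lia.
    rewrite ?andbF; apply: Or42; split; lia.
  + have -> : (k1 <= i) = false by lia.
    by rewrite ?andbF ?addn0; case: (st i) => -[*];
      [apply: Or41|apply: Or42|apply: Or43|apply: Or44]; split; lia.
  + subst k1; rewrite ltnn.
    rewrite ?andbT ?addn0.
    move: ev; rewrite /event_step; case: eqP => [lak [k1e _]|lak [ent g1e]]; first by lia.
    have e1 := ent i; have e2 := ent i.+1; move: g1e; rewrite gt orbT /= => g1e.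
    case: g1 g1e m4 => g1e m4.
      by apply: Or44; split; lia.
    by apply: Or42; split; lia.
- subst k.
  have a1 := l1 i ltac:(lia); have [b1 b2] := bel i ltac:(lia).
  have a2 := l2 i ltac:(lia); have a3 := l2 i.+1 ltac:(lia).
  have r1 := rm1 i; have r2 := rl1 i.+1; have kl := klow i.
  simpl in l3; have l3' := l3 ltac:(lia).
  rewrite ?eqxx ?ltnn ?andbT ?addn0 k1k.
  move: ev; rewrite /event_step; case: eqP => [lak [k1e g1e]|lak [ent g1e]].
    subst k1 g1; rewrite eqxx andbT ltnn ?addn0.
    by case: (st i) => -[*]; apply: Or41; split; lia.
  have e1 := ent i; have e2 := ent i.+1.
  have s2 : la1 i.+1 = (la i.+1).+1 by lia.
  have s3 : u1 i.+1 = (u i.+1).+1 /\ u1 i + mu i = mu1 i + u i.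
    by case: (st i) => -[]; lia.
  move: g1e.
  case: (ltngtP k1 i.+1) => [lt1|gt1|eq1].
  + have -> : k1 <= i by lia.
    rewrite ?andbF orbT /= => _.
    by case: g {l4} => /=; [apply: Or42|apply: Or43]; split; lia.
  + by lia.
  + subst k1; rewrite ltnn orbF andbT /= => g1e.
    case: (leqP (mu i) (la i.+1).+1) => d.
      have g10 : g1 = false by lia.
      by rewrite g10; case: g {l4 g1e} => /=; [apply: Or42|apply: Or43]; split; lia.
    have gg : g1 = g by lia.
    by rewrite gg; case: g {l4 g1e gg} => /=; apply: Or44; split; lia.
Qed.

(** * Inserting a whole row: uniqueness and reconstruction *)

Definition strict_levels (l : nat -> nat -> nat) :=
  (forall i, l 0 i = 0) /\ forall v, rook_strip (l v) (l v.+1).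

(* Rows are indexed by the second argument and levels by the first.  For fixed
   [i], [u ^~ i] counts the letters of the row that the sweep e_{k-1}^max, ...,
   e_i^max leaves in position [i]. *)
Definition row_ins (mu la u : nat -> nat -> nat) :=
  [/\ strict_levels mu, strict_levels la, forall v, hstrip (mu v) (la v) (u v) &
      forall v, level_step (mu v) (la v) (u v) (mu v.+1) (la v.+1) (u v.+1)].

(** Levels are descended one at a time. Inside a level the sweep is undone from row 0, where
    [u 0 = la 0]; each [sig_step] is determined by the growth of its output and by phi. *)
Lemma row_ins_backward mu la u mu' u' M :
  row_ins mu la u -> row_ins mu' la u' ->
  mu M =1 mu' M -> u M =1 u' M ->
  forall v, v <= M -> mu v =1 mu' v /\ u v =1 u' v.
Proof.
move=> [[_ rm] _ hs ls] [[_ rm'] _ hs' ls'] emu eu v vM.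
rewrite -(subKn vM); elim: (M - v) => [|d [IH1 IH2]]; first by rewrite subn0.
case: (leqP M d) => Md; first by have -> : M - d.+1 = M - d by lia.
have e : M - d = (M - d.+1).+1 by lia.
move: IH1 IH2; rewrite e; move: (M - d.+1) => w e1 e2.
have eu1 i : u w i = u' w i.
  elim: i => [|i IH]; first by have [-> _] := hs w; have [-> _] := hs' w.
  have := e1 i; have := e2 i; have := e2 i.+1.
  have [? ? ? ? ?] := (hs w).2 i; have [? ? ? ? ?] := (hs' w).2 i.
have := (rm w).1 i; have := (rm' w).1 i; have S := (ls w).2 i.
  by case: ((ls' w).2 i) => -[]; case: S => -[]; lia.
split=> // i.
have := eu1 i; have := eu1 i.+1.
have := e1 i; have := e2 i; have := e2 i.+1.
have [? ? ? ? ?] := (hs w).2 i; have [? ? ? ? ?] := (hs' w).2 i.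
have := (rm w).1 i; have := (rm' w).1 i; have S := (ls w).2 i.
by case: ((ls' w).2 i) => -[]; case: S => -[]; lia.
Qed.

Lemma row_ins_above mu la u K v :
  row_ins mu la u -> (forall i, K <= i -> mu v i = 0) ->
  forall i, (K < i -> la v i = 0) /\ (K <= i -> u v i = u v K).
Proof.
move=> [_ _ hs _] mu0 i.
have la0 j : K < j -> la v j = 0.
  case: j => // j Kj; have [] := (hs v).2 j; have := mu0 j ltac:(lia); lia.
split; first exact: la0.
move=> Ki; rewrite -(subnKC Ki); elim: (i - K) => [|d IH]; first by rewrite addn0.
rewrite addnS; have [] := (hs v).2 (K + d).
have := mu0 (K + d) ltac:(lia); have := la0 (K + d).+1 ltac:(lia); lia.
Qed.

(** Opposite direction to [row_ins_backward]: levels increase, and inside a level the sweep is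
    replayed from position K, where [u] counts the letters of the inserted row, up to row 0. *)
Lemma row_ins_forward mu la u la' u' K :
  row_ins mu la u -> row_ins mu la' u' ->
  (forall v i, K <= i -> mu v i = 0) ->
  (forall v, u v K = u' v K) ->
  forall v, la v =1 la' v /\ u v =1 u' v.
Proof.
move=> R R' mu0 eK.
have ab v := row_ins_above R (mu0 v); have ab' v := row_ins_above R' (mu0 v).
case: R R' => [_ [la0 _] hs ls] [_ [la0' _] hs' ls'].
elim=> [|v [IH1 IH2]].
  split=> i; first by rewrite la0 la0'.
  have [_ ab0] := ab 0 i; have [_ ab0'] := ab' 0 i.
  case: (leqP K i) => Ki; first by rewrite ab0 // ab0' // eK.
  have [h0 h] := hs 0; have [h0' h'] := hs' 0.
  have mub j : mu 0 j = 0 by have [] := h j; have := la0 j; lia.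
  elim: i {ab0 ab0' Ki} => [|i IH]; first by rewrite h0 h0' la0 la0'.
  have [] := h i; have [] := h' i; rewrite !la0 !la0' mub; lia.
have eu i : i <= K -> u v.+1 i = u' v.+1 i /\ la v.+1 i.+1 = la' v.+1 i.+1.
  move=> iK; rewrite -(subKn iK); elim: (K - i) => [|d [IH3 IH4]].
    by rewrite subn0 eK (ab v.+1 K.+1).1 // (ab' v.+1 K.+1).1.
  case: (leqP K d) => Kd; first by have -> : K - d.+1 = K - d by lia.
  have e : K - d = (K - d.+1).+1 by lia.
  move: IH3 IH4; rewrite e; move: (K - d.+1) => j e1 e2.
  have := IH1 j.+1; have := IH2 j; have := IH2 j.+1; have S := (ls v).2 j.
  by case: ((ls' v).2 j) => -[]; case: S => -[]; lia.
split=> i.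
  case: i => [|i]; first by have [<- _] := hs v.+1; have [<- _] := hs' v.+1; case: (eu 0).
  case: (leqP i K) => iK; first by case: (eu i iK).
  by rewrite (ab v.+1 i.+1).1 ?(ab' v.+1 i.+1).1 //; lia.
case: (leqP i K) => iK; first by case: (eu i iK).
by rewrite (ab v.+1 i).2 ?(ab' v.+1 i).2 ?eK //; lia.
Qed.

(* Recovers the increments of [x] and [y] in [sig_step] from those of [p] and [q]
   and from the value [phi] of x + p - (y + q) after the step. *)
Definition sig_step_inv (p q phi : nat) : nat * nat :=
  if q == 0 then
    if p == 0 then (0, 0) else
    if phi == 0 then (0, 1) else if phi == 1 then (1, 1) else (1, 0)
  else if (p == 0) || (phi == 0) then (0, 1) else (1, 1).

Section Down.
Context (mu1 la1 u1 la : nat -> nat).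

(** Here phi is read at the upper level, because the lower values of [mu i] and [u i.+1] are the
    unknowns. *)
Definition sig_step_inv_at i ui :=
  sig_step_inv (u1 i - ui) (la1 i.+1 - la i.+1) (mu1 i + u1 i - (u1 i.+1 + la1 i.+1)).

Fixpoint down_u i := if i is j.+1 then u1 j.+1 - (sig_step_inv_at j (down_u j)).2 else la 0.

Definition down_mu i := mu1 i - (sig_step_inv_at i (down_u i)).1.

Lemma down_step : hstrip mu1 la1 u1 -> rook_strip la la1 ->
  [/\ hstrip down_mu la down_u, rook_strip down_mu mu1 &
      level_step down_mu la down_u mu1 la1 u1].
Proof.
move=> [h0 h] [ri rs].
have ula i : la1 i <= u1 i.
  by elim: i => [|i IH]; [rewrite h0 | have [] := h i; lia].
(* In [sig_step], q grows only together with y, so a box is gained by [la i] only if [u i] grows.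
   This third bound is the invariant carried from i to i + 1; for i = 0 it comes from
   [u 0 = la 0]. *)
have key i : let x := down_u i in
    x <= u1 i -> u1 i <= x.+1 -> la1 i - la i <= u1 i - x ->
    [/\ [/\ down_mu i <= mu1 i, mu1 i <= (down_mu i).+1,
            down_u i.+1 <= u1 i.+1, u1 i.+1 <= (down_u i.+1).+1 &
            la1 i.+1 - la i.+1 <= u1 i.+1 - down_u i.+1],
        sig_step (down_mu i) (down_u i.+1) x (la i.+1) (mu1 i) (u1 i.+1) (u1 i) (la1 i.+1),
        mu1 i.+1 <= down_mu i &
        [/\ la i.+1 <= down_mu i, down_mu i <= la i,
    la i.+1 + x <= down_mu i + down_u i.+1,
    down_mu i + down_u i.+1 <= (la i.+1 + x).+1 &
    down_mu i <= la i.+1 -> down_mu i + down_u i.+1 <= la i.+1 + x]].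
  rewrite /down_mu /= /sig_step_inv_at; move: (down_u i) => x x1 x2 x3.
  have [h1 h2 h3 h4 h5] := h i; have [k1 k2 _ _ _] := h i.+1.
  have r1 := ri i; have r2 := ri i.+1; have r3 := rs i.
  have l1 := ula i; have l2 := ula i.+1.
  rewrite /sig_step_inv; case: (eqVneq (la1 i.+1 - la i.+1) 0) => q0.
    case: (eqVneq (u1 i - x) 0) => p0 /=.
      by split; [split; lia | apply: Or41; split; lia | lia | split; lia].
    case: eqVneq => f0 /=.
      by split; [split; lia | apply: Or42; split; lia | lia | split; lia].
    case: eqVneq => f1 /=.
      by split; [split; lia | apply: Or42; split; lia | lia | split; lia].
    by split; [split; lia | apply: Or41; split; lia | lia | split; lia].
  case: (eqVneq (u1 i - x) 0) => p0 /=.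
    by split; [split; lia | apply: Or44; split; lia | lia | split; lia].
  case: eqVneq => f0 /=.
    by split; [split; lia | apply: Or43; split; lia | lia | split; lia].
  case: (eqVneq (mu1 i + u1 i - (u1 i.+1 + la1 i.+1)) 1) => f1.
    by split; [split; lia | apply: Or43; split; lia | lia | split; lia].
  by split; [split; lia | apply: Or44; split; lia | lia | split; lia].
have pre i : [/\ down_u i <= u1 i, u1 i <= (down_u i).+1 &
                 la1 i - la i <= u1 i - down_u i].
  elim: i => [|i [p1 p2 p3]]; last by have [[]] := key i p1 p2 p3.
  by have := ri 0; rewrite /= h0; split; lia.
split.
- by split=> // i; have [p1 p2 p3] := pre i; have [_ _ _] := key i p1 p2 p3.
- split=> i; have [p1 p2 p3] := pre i; first by have [[]] := key i p1 p2 p3.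
  by have [_ _] := key i p1 p2 p3.
- split=> i; have [p1 p2 p3] := pre i; first by [].
  by have [_] := key i p1 p2 p3.
Qed.
End Down.

Lemma row_ins_exists la muM uM M :
  strict_levels la -> (forall v, M <= v -> la v =1 la M) -> hstrip muM (la M) uM ->
  exists mu u, [/\ row_ins mu la u, forall v, M <= v -> mu v =1 muM &
                  forall v, M <= v -> u v =1 uM].
Proof.
move=> [la0 rl] cst hM.
have [mu [u [hs rs ls [emu eu]]]] : exists mu u : nat -> nat -> nat,
  [/\ forall v, v <= M -> hstrip (mu v) (la v) (u v),
      forall v, v < M -> rook_strip (mu v) (mu v.+1),
      forall v, v < M -> level_step (mu v) (la v) (u v) (mu v.+1) (la v.+1) (u v.+1) &
      mu M = muM /\ u M = uM].
  elim: M muM uM hM {cst} => [|M IH] muM uM hM.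
    by exists (fun _ => muM), (fun _ => uM); split=> // v; rewrite leqn0 => /eqP->.
  have [d1 d2 d3] := down_step hM (rl M).
  have [mu [u [hs rs ls [emu eu]]]] := IH _ _ d1.
  exists (fun v => if v <= M then mu v else muM), (fun v => if v <= M then u v else uM).
  split=> [v vM|v vM|v vM|]; last by rewrite ltnn.
  - case: (leqP v M) => vM2; first exact: hs.
    by have -> : v = M.+1 by apply/eqP; rewrite eqn_leq vM vM2.
  - rewrite ltnS in vM; rewrite vM; case: (ltnP v M) => vM2; first exact: rs.
    have -> : v = M by lia.
    by rewrite emu.
  - rewrite ltnS in vM; rewrite vM; case: (ltnP v M) => vM2; first exact: ls.
    have -> : v = M by lia.
    by rewrite emu eu.
(* From level M on everything is frozen, hence the cut-off [minn v M]. *)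
have hs' v : hstrip (mu (minn v M)) (la v) (u (minn v M)).
  case: (leqP v M) => vM; first exact: hs.
  have [h0 h] := hM; rewrite emu eu.
  split=> [|i]; first by rewrite cst // ltnW.
  by rewrite !(cst v (ltnW vM)).
have mu0 i : mu 0 i = 0 by have [_ /(_ i)[_]] := hs' 0; rewrite min0n la0; lia.
exists (fun v => mu (minn v M)), (fun v => u (minn v M)); split.
- split=> //.
  + split=> [i|v]; first by rewrite min0n.
    case: (ltnP v M) => vM; first by rewrite (minn_idPl vM); exact: rs.
    rewrite (minn_idPr (leqW vM)) emu; split=> i //.
    have [_ h] := hM; have [_ b _ _ _] := h i.+1; have [c _ _ _ _] := h i; lia.
  + move=> v; case: (ltnP v M) => vM.
      by rewrite (minn_idPl vM); exact: ls.
    rewrite (minn_idPr (leqW vM)) emu eu; split=> i //.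
    by apply: Or41; split; rewrite 1?addnC // cst ?(cst v) // leqW.
- by move=> v vM i; rewrite (minn_idPr vM) emu.
- by move=> v vM i; rewrite (minn_idPr vM) eu.
Qed.

(** * Tableaux and Hecke insertion *)

Local Notation row T i := (nth [::] T i).
Local Notation rowsz T i := (size (nth [::] T i)).

Lemma geq_transitive : transitive geq.
Proof. by move=> u v w h1 h2; apply: leq_trans h2 h1. Qed.

Lemma sorted_geq_shape A (T : tableau A) :
  sorted geq (shape T) -> forall i j, i <= j -> rowsz T j <= rowsz T i.
Proof.
move=> srt i j ij; rewrite -!nth_shape; case: (ltnP j (size (shape T))) => jT.
  by apply: (sorted_leq_nth geq_transitive leqnn) => //; rewrite inE (leq_ltn_trans ij).
by rewrite (nth_default 0 jT).
Qed.

Lemma columnE A (T : tableau A) c : sorted geq (shape T) ->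
  (forall i, (i < size (column T c)) = (c < rowsz T i)) /\
  (forall x0 i, i < size (column T c) ->
     nth x0 (column T c) i = nth x0 (row T i) c).
Proof.
elim: T => [|r T IH] srt; first by split=> [i|x0 i]; rewrite //= nth_nil.
have [IH1 IH2] := IH (path_sorted srt).
rewrite /column /=; case E: (onth r c) => [y|] /=.
  have cr : c < size r by rewrite -onthTE E.
  split=> [[|i]|x0 [|i]] //=; [exact: IH1|by rewrite (onth_nth _ _ _ _ E)|exact: IH2].
have cr : size r <= c by rewrite -onthNE E.
have c0 : size (column T c) = 0.
  apply/eqP; rewrite -leqn0 leqNgt IH1 -leqNgt; apply: leq_trans cr.
  exact: (sorted_geq_shape srt (leq0n 1)).
rewrite -/(column T c) c0; split=> [i|//].
by rewrite ltn0 ltnNge (leq_trans (sorted_geq_shape srt (leq0n i))).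
Qed.

(** Kept generic in the row and column relations, to serve both [increasing] and [semistandard]. *)
Lemma tableauP (A : Type) (x0 : A) (r1 r2 : rel A) (T : tableau A) :
  reflect [/\ forall i, i < size T -> 0 < rowsz T i,
      forall i, rowsz T i.+1 <= rowsz T i,
      forall i c, c.+1 < rowsz T i -> r1 (nth x0 (row T i) c) (nth x0 (row T i) c.+1) &
      forall i c, c < rowsz T i.+1 -> r2 (nth x0 (row T i) c) (nth x0 (row T i.+1) c)]
    [&& young_diagram (shape T), all (sorted r1) T & all (sorted r2) (columns T)].
Proof.
apply: (iffP and3P) => [[/andP[srt n0] rows cols]|[h1 h2 h3 h4]].
  have C c := columnE c srt.
  split.
  - move=> i iT; rewrite lt0n; apply: contra n0 => /eqP e.
    by rewrite -e -nth_shape mem_nth // size_map.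
  - by move=> i; apply: sorted_geq_shape.
  - move=> i c ic; case: (ltnP i (size T)) => iT; last by rewrite nth_default in ic.
    by apply/(sortedP _ (e := r1)): ic; apply: (all_nthP [::] rows).
  - move=> i c ic; have [C1 C2] := C c.
    have cT : c < size (head [::] T).
      by rewrite -nth0; apply: leq_trans ic (sorted_geq_shape srt (leq0n _)).
    have := all_nthP [::] cols c; rewrite size_mkseq => /(_ cT).
    rewrite nth_mkseq // => /(sortedP x0)/(_ i); rewrite C1 => /(_ ic).
    by rewrite !C2 ?C1 // (leq_trans ic) // sorted_geq_shape.
have srt : sorted geq (shape T).
  by apply/(sortedP 0) => i _; rewrite !nth_shape /=.
have C c := columnE c srt.
split.
- rewrite /young_diagram srt; apply/negP => /(nthP 0)[i].
  by rewrite size_map => iT; rewrite nth_shape => e; have := h1 i iT; rewrite e.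
- by apply/(all_nthP [::]) => i iT; apply/(sortedP x0) => c; apply: h3.
- apply/(all_nthP [::]) => c; rewrite size_mkseq => cT; rewrite nth_mkseq //.
  have [C1 C2] := C c; apply/(sortedP x0) => i ic.
  by rewrite !C2 ?(ltnW ic) //; apply: h4; rewrite -C1.
Qed.

Definition ent (T : tableau nat) i c := nth 0 (row T i) c.
Definition lev (T : tableau nat) v i := count (fun y => y < v) (row T i).

Lemma increasingP T :
  reflect [/\ forall i, i < size T -> 0 < rowsz T i,
      forall i, rowsz T i.+1 <= rowsz T i,
      forall i c, c.+1 < rowsz T i -> ent T i c < ent T i c.+1 &
      forall i c, c < rowsz T i.+1 -> ent T i c < ent T i.+1 c]
    (increasing T).
Proof. exact: tableauP. Qed.

Lemma increasing_shape T : increasing T -> sorted geq (shape T).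
Proof. by case/and3P => /andP[]. Qed.

Lemma prefix_count A (x0 : A) (p : pred A) s c :
  (forall c, c.+1 < size s -> p (nth x0 s c.+1) -> p (nth x0 s c)) ->
  (c < count p s) = (c < size s) && p (nth x0 s c).
Proof.
elim: s c => [|a s IH] c //= h.
have {}IH := IH _ (fun c => h c.+1).
case pa : (p a) => /=.
  by case: c => [|c]; rewrite ?pa // add1n !ltnS IH.
have np d : d < size s -> p (nth x0 s d) = false.
  elim: d => [|d IHd] ds; apply/negP => pd; first by have := h 0 ds pd; rewrite pa.
  by have := h d.+1 ds pd; rewrite /= IHd // ltnW.
rewrite add0n; case: c => [|c]; rewrite /= ?pa IH.
  by case: (ltnP 0 (size s)) => // h0; rewrite np.
rewrite ltnS; case: (ltnP c.+1 (size s)) => h1; last first.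
  by case: (ltnP c (size s)) => //= h2; rewrite np.
by rewrite !np // ltnW.
Qed.

Lemma sorted_ltn_count s c v :
  sorted ltn s -> (c < count (fun y => y < v) s) = (c < size s) && (nth 0 s c < v).
Proof.
move=> /(sortedP 0) srt; apply: prefix_count => d ds.
exact/ltn_trans/srt.
Qed.

Lemma row_sorted T i : increasing T -> sorted ltn (row T i).
Proof.
case/and3P => _ /all_nthP h _; case: (ltnP i (size T)) => iT; first exact: h.
by rewrite nth_default.
Qed.

Lemma lt_lev T v i c : increasing T ->
  (c < lev T v i) = (c < rowsz T i) && (ent T i c < v).
Proof. by move=> /(row_sorted i); exact: sorted_ltn_count. Qed.

Lemma leq_ent_col T i j c : increasing T -> i <= j -> c < rowsz T j ->
  ent T i c + (j - i) <= ent T j c.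
Proof.
move=> inc /subnKC <-; rewrite addKn.
have srt := increasing_shape inc; case/increasingP: inc => _ _ _ h.
elim: (j - i) => [|k IH]; first by rewrite !addn0.
rewrite !addnS => lt; apply: leq_ltn_trans (IH _) (h _ _ lt).
by apply: leq_trans lt _; apply: sorted_geq_shape.
Qed.

Lemma lev_strict_levels T : increasing T -> strict_levels (lev T).
Proof.
move=> inc; split=> [i|v].
  by apply/eqP; rewrite -leqn0 leqNgt lt_lev // ltn0 andbF.
split=> i.
  split; first by apply: sub_count => y; exact: ltnW.
  rewrite leqNgt lt_lev //; apply/negP => /andP[sz e].
  suff : (lev T v i) < lev T v i by rewrite ltnn.
  rewrite lt_lev // (ltn_trans _ sz) //= -ltnS.
  by apply: leq_trans e; rewrite ltnS; case/increasingP: inc => _ _ h _; apply: h.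
rewrite leqNgt lt_lev //; apply/negP => /andP[sz e].
suff : (lev T v i) < lev T v i by rewrite ltnn.
have le : rowsz T i.+1 <= rowsz T i by case/increasingP: inc.
rewrite lt_lev // (leq_trans sz le) /= -ltnS.
by apply: leq_trans e; rewrite ltnS; case/increasingP: inc => _ _ _ h; apply: h.
Qed.

Lemma count_ltnS v s : count (fun y => y < v.+1) s = count (fun y => y < v) s + count_mem v s.
Proof. by elim: s => //= a s ->; case: (ltngtP a v); lia. Qed.

Lemma lev_inj T T' : increasing T -> increasing T' ->
  (forall v i, lev T v i = lev T' v i) -> T = T'.
Proof.
move=> inc inc' e.
have rows i : row T i = row T' i.
  apply: (irr_sorted_eq ltn_trans ltnn) (row_sorted i inc) (row_sorted i inc') _ => y.
  have := e y.+1 i; rewrite /lev !count_ltnS; have := e y i; rewrite /lev => -> /addnI e2.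
  by rewrite -!has_pred1 !has_count e2.
have sz (S S' : tableau nat) : increasing S -> (forall i, row S i = row S' i) -> size S <= size S'.
  move=> /increasingP[h _ _ _] r; rewrite leqNgt; apply/negP => lt.
  by have := h _ lt; rewrite r nth_default.
apply: (@eq_from_nth _ [::]) => // .
by apply/eqP; rewrite eqn_leq !sz.
Qed.

Section SetBox.
Context (T : tableau nat) (k c x : nat).

Lemma ent_set_box i d :
  ent (set_box 0 T k c x) i d = if (i == k) && (d == c) then x else ent T i d.
Proof.
rewrite /ent nth_set_nth /=; case: eqP => [->|] //=.
by rewrite nth_set_nth.
Qed.

Lemma rowsz_set_box i :
  rowsz (set_box 0 T k c x) i = if i == k then maxn c.+1 (rowsz T k) else rowsz T i.
Proof. by rewrite nth_set_nth /=; case: eqP => // _; rewrite size_set_nth. Qed.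

(** Only the left and upper neighbours need a test: x is smaller than the entry it replaces, so it
    stays below the right and lower neighbours. *)
Lemma increasing_set_box :
  increasing T -> c <= rowsz T k -> (0 < k -> c < rowsz T k.-1) ->
  (c < rowsz T k -> x < ent T k c) ->
  increasing (set_box 0 T k c x) =
    ((c == 0) || (ent T k c.-1 < x)) && ((k == 0) || (ent T k.-1 c < x)).
Proof.
move=> inc ck kc xlt; have srt := increasing_shape inc.
case/increasingP: (inc) => t1 t2 t3 t4.
apply/increasingP/andP => [[h1 h2 h3 h4]|[h1 h2]].
  split.
    case: (posnP c) => // c0; have := h3 k c.-1.
    rewrite !ent_set_box rowsz_set_box eqxx prednK // eqxx /=.
    have -> : (c.-1 == c) = false by lia.
    by move=> -> //; rewrite leq_maxl.
  case: (posnP k) => // k0; have := h4 k.-1 c.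
  rewrite !ent_set_box rowsz_set_box prednK // !eqxx /=.
  have -> : (k.-1 == k) = false by lia.
  by move=> -> //; rewrite leq_maxl.
have kT : k <= size T.
  case: (posnP k) => [->//|k0]; rewrite leqNgt; apply/negP => lt.
  by have := kc k0; rewrite nth_default //; lia.
split.
- move=> i; rewrite size_set_nth rowsz_set_box; case: eqP => [_ _|ik iT].
    by rewrite leq_max.
  by apply: t1; lia.
- move=> i; rewrite !rowsz_set_box; have := t2 i.
  case: (eqVneq i.+1 k) => [e|_].
    have -> : (i == k) = false by lia.
    by have := kc; rewrite -e /=; lia.
  by case: (eqVneq i k) => [->|]; lia.
- move=> i d; rewrite !ent_set_box rowsz_set_box.
  case: (eqVneq i k) => [->|_] /=; last exact: t3.
  have := t3 k d; have := xlt.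
  case: (eqVneq d.+1 c) h1 => [<- /= h1|ne _].
    by have -> : (d == d.+1) = false by lia.
  case: (eqVneq d c) => [->|]; lia.
- move=> i d; rewrite !ent_set_box rowsz_set_box.
  case: (eqVneq i.+1 k) h2 ck => [<-|ne _ _] /=.
    have -> : (i == i.+1) = false by lia.
    by case: (eqVneq d c) => [->|] //=; have := t4 i d; lia.
  case: (eqVneq i k) => [->|_] /=; last exact: t4.
  case: (eqVneq d c) => [->|_]; last exact: t4.
  move=> lt; apply: ltn_trans (t4 _ _ lt); apply: xlt.
  exact: leq_trans lt (t2 k).
Qed.

Lemma lev_set_box v i : c <= rowsz T k ->
  lev (set_box 0 T k c x) v i + ((i == k) && (c < rowsz T k) && (ent T k c < v)) =
  lev T v i + ((i == k) && (x < v)).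
Proof.
move=> ck; rewrite /lev nth_set_nth /=; case: eqP => [->|] //=.
rewrite count_set_nth; have -> : c - rowsz T k = 0 by lia.
rewrite muln0 addn0 -/(ent T k c).
case: (ltnP c (rowsz T k)) => ck2; rewrite ?muln1 ?muln0 ?subn0 ?addn0 //=.
rewrite subnK //; case: (ltnP (ent T k c) v) => // ev.
have : 0 < count (fun y => y < v) (row T k); last by lia.
by rewrite -has_count; apply/hasP; exists (ent T k c); [apply: mem_nth|].
Qed.
End SetBox.

Lemma event_step_ext la la1 la' la1' k g k1 g1 :
  la =1 la' -> la1 =1 la1' -> event_step la la1 k g k1 g1 -> event_step la' la1' k g k1 g1.
Proof.
move=> e e1; rewrite /event_step /enters !e !e1; case: ifP => // _ [h ->].
by split=> // j; rewrite -e1.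
Qed.

(* Where a letter inserted in column [c] may come from: it was the entry of the
   box [(k, c - 1)], which is possibly unchanged. *)
Definition insertable T c x :=
  c = 0 \/ exists k, [/\ k < size T, c <= rowsz T k, ent T k c.-1 <= x,
    c < rowsz T k -> x < ent T k c & ent T k c.-1 = x -> 0 < k].

Definition left_free T c x k := (c == 0) || (ent T k c.-1 < x).

(* [K v] and [g v] form the event at level [v]; it is constant between two
   consecutive bumped letters. *)
Definition event_path (T T' : tableau nat) (box : nat * nat) c x :=
  exists K : nat -> nat, exists g : nat -> bool,
  [/\ enters (lev T x) (lev T x.+1) c (left_free T c x (K x.+1)) (K x.+1) (g x.+1),
      forall v, x < v -> event_step (lev T v) (lev T v.+1) (K v) (g v) (K v.+1) (g v.+1),
      forall v i, lev T' v i = lev T v i + [&& x < v, g v & i == K v] &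
      exists V, forall v, V <= v -> x < v /\
        box = (K v - ~~ g v, (rowsz T' (K v - ~~ g v)).-1)].

(** If x bumps y from box (k, c), then row k has exactly c entries below v for all x < v <= y, so
    the event is constant on these levels. At the step from y to y + 1 the box of y becomes visible,
    and [event_step] moves to the next column. The recursive call speaks of [T1] instead of T, but
    their level counts differ only for x < v <= y. *)
Lemma hecke_fromP fuel T c x : increasing T -> insertable T c x ->
  size (head [::] T) < fuel + c ->
  let res := hecke_from fuel T c x in
  increasing res.1 /\ event_path T res.1 res.2 c x.
Proof.
elim: fuel T c x => [|fuel IH] T c x inc pre fl.
  case: pre => [c0|[k [kT ck _ _ _]]]; first by rewrite c0 ltn0 in fl.
  have := sorted_geq_shape (increasing_shape inc) (leq0n k); rewrite nth0; lia.
rewrite /=; set col := column T c; set k := find _ col; set T' := set_box 0 T k c x.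
have srt := increasing_shape inc.
have [C1 C2] := columnE c srt; rewrite -/col in C1 C2.
have [t1 t2 t3 t4] := increasingP _ inc.
have bef j : j < k -> c < rowsz T j /\ ent T j c <= x.
  move=> jk; have jc : j < size col by apply: leq_trans jk (find_size _ _).
  split; first by rewrite -C1.
  by have := before_find 0 jk; rewrite C2 //= -/(ent T j c); lia.
have klev j : (c < lev T x.+1 j) = (j < k).
  rewrite lt_lev // ltnS; apply/andP/idP => [[cj ej]|/bef//].
  rewrite ltnNge; apply/negP => kj.
  have hk : has (ltn x) col by rewrite has_find; apply: leq_ltn_trans kj _; rewrite C1.
  have := nth_find 0 hk; rewrite -/k C2 -?has_find // -/(ent T k c) /=.
  by have := leq_ent_col inc kj cj; lia.
(* The letter came from row k0 of the previous column and [k <= k0], so box (k, c) is adjacent to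
   row k and its left neighbour is at most x. *)
have szk : c <= rowsz T k /\ (0 < c -> ent T k c.-1 <= x /\ (ent T k c.-1 = x -> 0 < k)).
  case: pre => [->//|[k0 [k0T ck e1 e2 e3]]].
  have kk0 : k <= k0.
    rewrite leqNgt; apply/negP => /bef[a b]; have := e2 a; lia.
  have sz0 := sorted_geq_shape srt kk0; split; first exact: leq_trans ck sz0.
  move=> c0; have := leq_ent_col inc kk0; move=> /(_ c.-1 ltac:(lia)).
  by move=> ?; split; [lia|move=> ?; case: (posnP k) => // kz; have := e3; lia].
case: szk => ck lft.
have kup : 0 < k -> c < rowsz T k.-1 by move=> k0; have [] := bef k.-1 ltac:(lia).
have upx : 0 < k -> ent T k.-1 c <= x by move=> k0; have [] := bef k.-1 ltac:(lia).
have xk : c < rowsz T k -> x < ent T k c.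
  move=> cj; have hk : has (ltn x) col.
    rewrite has_find -/k; by rewrite C1.
  by have := nth_find 0 hk; rewrite -/k C2 // -has_find.
have incE : increasing T' = left_free T c x k && ((k == 0) || (c < lev T x k.-1)).
  rewrite increasing_set_box //; congr (_ && _).
  case: (posnP k) => k0 //=.
  by rewrite lt_lev // kup.
(* In row 0 a placement never fails, so an absorbed letter always has a row k - 1 in which to
   end. *)
have g0 : increasing T' || (0 < k).
  case: (posnP k) => k0; last by rewrite orbT.
  rewrite incE /left_free k0 /= andbT orbF; case: (posnP c) => //= c0.
  have [a b] := lft c0; rewrite k0 in a b.
  by rewrite ltn_neqAle a andbT; apply/eqP => /b.
have levk v : x < v -> (c < rowsz T k -> v <= ent T k c) -> lev T v k = c.
  move=> xv vy; apply/eqP; rewrite eqn_leq leqNgt lt_lev //; apply/andP; split.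
    by apply/negP => /andP[a]; have := vy a; lia.
  case: (posnP c) => [->//|c0]; rewrite -(prednK c0) lt_lev //.
  by have [a _] := lft c0; rewrite (leq_ltn_trans a xv) andbT; lia.
rewrite C1; case: (ltnP c (rowsz T k)) => ck2; last first.
  have -> : (rowsz T k == c) && increasing T' = increasing T' by rewrite eqn_leq ck ck2.
  have lv v i : lev (if increasing T' then T' else T) v i =
     lev T v i + [&& x < v, increasing T' & i == k].
    case: ifP => _; last by rewrite andbF addn0.
    have := lev_set_box x v i ck; rewrite ltnNge ck2 andbF /= addn0 => ->.
    by rewrite andbC.
  have st : event_path T (if increasing T' then T' else T)
      (k - ~~ increasing T', (rowsz (if increasing T' then T' else T) (k - ~~ increasing T')).-1) c x.
    exists (fun _ => k), (fun _ => increasing T'); split=> //.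
    + move=> v xv; rewrite /event_step levk; [|lia|lia].
      by rewrite levk ?eqxx //; lia.
    + by exists x.+1 => v.
  case: ifP st => gg /= st; split=> //.
    move: st; rewrite subn0 rowsz_set_box eqxx.
    by have -> : maxn c.+1 (rowsz T k) = c.+1 by lia.
  move: st; rewrite subn1; suff -> : size col = k by [].
  apply/eqP; rewrite eqn_leq find_size andbT leqNgt C1 -leqNgt; exact: ck2.
rewrite C2 ?C1 // -/(ent T k c); set y := ent T k c; set T1 := if _ then T' else T.
have xy : x < y by apply: xk.
have kT : k < size T.
  by rewrite ltnNge; apply/negP => h; rewrite nth_default in ck2.
have inc1T : increasing T1 by rewrite /T1; case: ifP.
have sz1 i : rowsz T1 i = rowsz T i.
  rewrite /T1; case: ifP => // _; rewrite rowsz_set_box; case: eqP => // ->; lia.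
have ent1 i d : ent T1 i d = if increasing T' && (i == k) && (d == c) then x else ent T i d.
  by rewrite /T1; case: ifP => //= _; rewrite ent_set_box.
have lv1 v i : lev T1 v i = lev T v i + [&& x < v, v <= y, increasing T' & i == k].
  rewrite /T1; case: ifP => gg; rewrite ?andbF ?addn0 //=.
  have := lev_set_box x v i ck; rewrite ck2 andbT -/y => h.
  by rewrite -/T' in h; case: (i == k) h => /= h; rewrite ?andbF ?andbT ?addn0; lia.
have pre1 : insertable T1 c.+1 y.
  right; exists k; rewrite sz1 !ent1 /= eqxx andbT (gtn_eqF (ltnSn c)) !eqxx andbT andbF.
  split=> //.
  - by rewrite /T1; case: ifP => // _; rewrite size_set_nth leq_max ltnSn.
  - by case: ifP => _; [apply: ltnW|].
  - by move=> c1; apply: t3.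
  - by case: ifP g0 => //= _ _; lia.
have fl1 : size (head [::] T1) < fuel + c.+1.
  by rewrite -nth0 sz1 nth0 addnS -addSn.
have [incr [K [g [ent0 steps lv [V fin]]]]] := IH T1 c.+1 y inc1T pre1 fl1.
split=> //.
have lv1y v i : y < v -> lev T1 v i = lev T v i.
  by move=> yv; rewrite lv1 (leqNgt v y) yv /= andbF addn0.
exists (fun v => if v <= y then k else K v), (fun v => if v <= y then increasing T' else g v).
split.
- by rewrite xy.
- move=> v xv; case: (ltngtP v y) => vy.
  + rewrite /event_step !levk ?eqxx //; lia.
  + by apply: event_step_ext (steps v vy) => i; apply: lv1y; lia.
  + subst v; have [e1 e2] := ent0.
    have ly : lev T y k = c by apply: levk.
    have ly1 : lev T y.+1 k = c.+1.
      apply/eqP; rewrite eqn_leq; have [_ /(_ y)[/(_ k)[_ h] _]] := lev_strict_levels inc.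
      by rewrite -{1}ly h lt_lev // ck2 /= ltnS.
    have e1' j : (c.+1 < lev T y.+1 j) = (j < K y.+1) by rewrite -e1 lv1y.
    have Kk : K y.+1 <= k by rewrite leqNgt -e1' ly1 ltnn.
    rewrite /event_step ly ly1 (gtn_eqF (ltnSn c)); split=> //.
    rewrite e2; congr (_ && _).
      (* Left neighbour of y in the next column: in a row above k it is smaller than y; in row k it
         is x if the replacement took place, and y itself otherwise. *)
      rewrite /left_free /= ent1 eqxx andbT.
      case: (ltngtP (K y.+1) k) Kk => // [lt|->] _.
        rewrite orbT andbF; have := leq_ent_col inc (ltnW lt) ck2; rewrite -/y; lia.
      by rewrite orbF andbT; case: ifP => // _; rewrite ltnn.
    case: (posnP (K y.+1)) => k0 //=.
    rewrite lv1; have -> : (K y.+1).-1 == k = false by lia.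
    by rewrite !andbF addn0.
- move=> v i; rewrite lv lv1.
  case: (ltngtP v y) => vy; rewrite ?andbT ?andbF ?addn0 //=.
  by rewrite (ltn_trans xy vy).
- exists (maxn V y.+1) => v; rewrite geq_max => /andP[Vv yv].
  have [_ ->] := fin v Vv; rewrite (leqNgt v y) yv /=; split=> //; exact: ltn_trans yv.
Qed.

(** * From one letter to a whole row, with the recording tableau *)

Lemma level_step_refl mu mu1 : rook_strip mu mu1 -> (forall i, mu i.+1 <= mu i) ->
  level_step mu mu mu mu1 mu1 mu1.
Proof.
move=> [r1 r2] mon; split=> // i; have := r1 i.+1; have := r2 i; have := mon i.
case: (eqVneq (mu1 i.+1) (mu i.+1)) => e h1 h2 h3.
  by apply: Or41; split; lia.
by apply: Or44; split; lia.
Qed.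

Lemma strict_levels_mono mu : strict_levels mu -> forall v i, mu v i.+1 <= mu v i.
Proof.
move=> [m0 mr] [|v] i; first by rewrite !m0.
have [r1 r2] := mr v; have := r1 i; have := r2 i; lia.
Qed.

Lemma row_ins_refl mu : strict_levels mu -> row_ins mu mu mu.
Proof.
move=> lm; have mon := strict_levels_mono lm; split=> // v.
  by split=> // i; have := mon v i; split; lia.
by apply: level_step_refl; [apply: lm.2|apply: mon].
Qed.

Lemma enters_legal mu mu1 k g : rook_strip mu mu1 ->
  enters mu mu1 0 true k g -> legal mu1 mu1 mu1 k g.
Proof.
move=> [r1 r2] [e ->]; split=> //.
  by move=> k0; have := e k; have := e k.-1; lia.
by case: (posnP k); rewrite //= orbT.
Qed.

Lemma enters_sig mu mu1 k g : rook_strip mu mu1 -> (forall i, mu i.+1 <= mu i) ->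
  enters mu mu1 0 true k g ->
  level_step mu mu mu mu1 (event_la mu1 k g) (event_u mu1 k).
Proof.
move=> [r1 r2] mon [e eg]; rewrite /event_la /event_u.
split=> [i|i]; first by have := r1 i; have := e i; lia.
have a1 := r1 i; have a2 := r1 i.+1; have a3 := r2 i; have a4 := mon i.
have e1 := e i; have e2 := e i.+1.
case: (ltngtP i.+1 k) => [lt|gt|eq].
- have -> : (k <= i) = false by lia.
  rewrite ?andbF; case: (eqVneq (mu1 i.+1) (mu i.+1)) => ee.
    by apply: Or41; split; lia.
  by apply: Or44; split; lia.
- have -> : k <= i by lia.
  by rewrite ?andbF; apply: Or42; split; lia.
- subst k; rewrite ltnn andbT eg /=.
  case: (posnP (mu i)) => m0; first by apply: Or42; split; lia.
  by apply: Or44; split; lia.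
Qed.

(** Levels up to x do not change. At level x + 1 the letter creates a legal event, because there
    [la] and [u] still equal [mu]; [event_step] then propagates legality and [level_step] to all
    higher levels. *)
Lemma row_ins_event mu la u x la' u' K g :
  row_ins mu la u ->
  (forall v, v <= x.+1 -> la v = mu v /\ u v = mu v) ->
  enters (la x) (la x.+1) 0 true (K x.+1) (g x.+1) ->
  (forall v, x < v -> event_step (la v) (la v.+1) (K v) (g v) (K v.+1) (g v.+1)) ->
  (forall v i, la' v i = la v i + [&& x < v, g v & i == K v]) ->
  (forall v i, u' v i = u v i + ((x < v) && (K v <= i))) ->
  strict_levels la' ->
  (forall v, x < v -> legal (mu v) (la v) (u v) (K v) (g v)) /\
  row_ins mu la' u'.
Proof.
move=> [lm ll hs ls] eq0 en st e' eu' ll'.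
have mon := strict_levels_mono lm.
have [ex1 ux1] := eq0 x.+1 (leqnn _); have [ex ux] := eq0 x (leqnSn _).
rewrite ex ex1 in en.
have lg v : x < v -> legal (mu v) (la v) (u v) (K v) (g v).
  move=> /subnKC <-; elim: (v - x.+1) => [|d IH].
    rewrite addn0 ex1 ux1; apply: (enters_legal _ en); exact: lm.2.
  rewrite addnS; have [] // := event_step_legal (lm.2 (x.+1 + d)) (ll.2 _) (hs _) (hs _) (ls _) IH (st _ _).
  by rewrite ltnS leq_addr.
split=> //.
have la'E v : x < v -> la' v = event_la (la v) (K v) (g v).
  by move=> xv; apply/funext => i; rewrite e' xv.
have la'E0 v : v <= x -> la' v = la v.
  by move=> vx; apply/funext => i; rewrite e' ltnNge vx addn0.
have u'E v : x < v -> u' v = event_u (u v) (K v).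
  by move=> xv; apply/funext => i; rewrite eu' xv.
have u'E0 v : v <= x -> u' v = u v.
  by move=> vx; apply/funext => i; rewrite eu' ltnNge vx addn0.
split=> // v.
  case: (ltnP x v) => xv; first by rewrite la'E // u'E //; apply: hstrip_event (hs v) (lg v xv).
  by rewrite la'E0 // u'E0.
case: (ltngtP x v) => xv.
- have xv1 : x < v.+1 by apply: leqW.
  rewrite (la'E _ xv) (la'E _ xv1) (u'E _ xv) (u'E _ xv1).
  exact: event_step_sig (lm.2 _) (ll.2 _) (hs _) (hs _) (ls _) (lg v xv) (st v xv).
- have xv1 : v <= x by apply: ltnW.
  by rewrite (la'E0 _ xv) (la'E0 _ xv1) (u'E0 _ xv) (u'E0 _ xv1).
- subst v; rewrite la'E0 // la'E // u'E0 // u'E // ex ux ex1 ux1.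
  by apply: enters_sig en; [apply: lm.2|apply: mon].
Qed.

Lemma lev_rowsz T : exists V, forall v i, V <= v -> lev T v i = rowsz T i.
Proof.
elim: T => [|r T [V IH]]; first by exists 0 => v i _; rewrite /lev nth_nil.
exists (maxn V (\max_(y <- r) y).+1) => v [|i]; rewrite geq_max => /andP[Vv rv].
  rewrite /lev /=; apply/eqP; rewrite -all_count; apply/allP => y yr.
  by apply: leq_trans rv; rewrite ltnS; apply: leq_bigmax_seq.
exact: IH.
Qed.

Local Notation box Q i c := (nth finset.set0 (nth [::] Q i) c).

Lemma box_set_box n (Q : svtableau n) r c X i d :
  box (set_box finset.set0 Q r c X) i d = if (i == r) && (d == c) then X else box Q i d.
Proof.
rewrite nth_set_nth /=; case: eqP => [->|] //=.
by rewrite nth_set_nth.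
Qed.

Lemma rowsz_set_box_sv n (Q : svtableau n) r c X i :
  rowsz (set_box finset.set0 Q r c X) i = if i == r then maxn c.+1 (rowsz Q r) else rowsz Q i.
Proof. by rewrite nth_set_nth /=; case: eqP => // _; rewrite size_set_nth. Qed.

Lemma increasing_size T i : increasing T -> (i < size T) = (0 < rowsz T i).
Proof.
case/increasingP => h _ _ _; apply/idP/idP; first exact: h.
by case: (ltnP i (size T)) => // iT; rewrite nth_default.
Qed.

(** The bound b is the previous letter. The next one, x < b, starts at level x + 1 <= b, where
    nothing has happened yet. *)
Definition insertion_state mu (T : tableau nat) u b :=
  [/\ increasing T, row_ins mu (lev T) u &
      forall v, v <= b -> lev T v = mu v /\ u v = mu v].

(* [l] is in the boxes of row [i] from column [mu i - delta] to [la i - 1], where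
   [mu i - delta = la (i + 1) + u i - u (i + 1)]. *)
Definition records n (l : 'I_n) (Q0 Q : svtableau n) (T : tableau nat) (u : nat -> nat -> nat) :=
  [/\ size Q = size T, forall i, rowsz Q i = rowsz T i &
  exists V, forall v, V <= v -> forall i c l', (l' \in box Q i c) =
    if l' == l then (lev T v i.+1 + u v i <= c + u v i.+1) && (c < lev T v i)
    else l' \in box Q0 i c].

(** The box where the insertion ends is read off at levels exceeding all entries. With k the row of
    the event there, a new box extends the interval of [records] in row k on the right. An absorbed
    letter lowers the left end in row k - 1, where the interval was empty by legality and becomes
    the last box. *)
Lemma hecke_step_row n mu T u b (Q0 Q : svtableau n) l x :
  insertion_state mu T u b -> x < b -> records l Q0 Q T u ->
  let TQ := hecke_step (T, Q) (x, l) in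
  exists u', [/\ insertion_state mu TQ.1 u' x, records l Q0 TQ.2 TQ.1 u' &
    forall k, (forall v i, k <= i -> mu v i = 0) ->
    forall v, u' v k = u v k + (x < v)].
Proof.
move=> [inc ri eb] xb [sQ rQ [V memQ]] /=.
rewrite /hecke_step /=.
have := @hecke_fromP (size (head [::] T)).+1 T 0 x inc (or_introl erefl).
rewrite addn0 ltnSn -/(hecke_insert T x).
case E : (hecke_insert T x) => [T' [r c]] /= /(_ isT) [inc' [K [g [en st e' [V2 fin]]]]].
pose u' v i := u v i + ((x < v) && (K v <= i)).
have eq0 v : v <= x.+1 -> lev T v = mu v /\ u v = mu v.
  by move=> vx; apply: eb; apply: leq_trans vx xb.
have [lg ri'] := row_ins_event (u' := u') ri eq0 en st e' (fun _ _ => erefl) (lev_strict_levels inc').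
have [V3 top] := lev_rowsz T; have [V4 top'] := lev_rowsz T'.
pose W := maxn (maxn V V2) (maxn (maxn V3 V4) x.+1).
have bigW v : W <= v -> [/\ V <= v, V2 <= v, V3 <= v, V4 <= v & x < v].
  by rewrite /W !geq_max => /andP[/andP[-> ->] /andP[/andP[-> ->] ->]].
exists u'; split.
- split=> // v vx; have [e1 e2] := eq0 v (leqW vx).
  split; apply/funext => i; rewrite ?e' ?/u' ltnNge vx /= addn0; [by rewrite e1|by rewrite e2].
- have WW := bigW W (leqnn _).
  have rw v : W <= v -> [/\ r = K v - ~~ g v, c = (rowsz T' r).-1,
      (forall i, rowsz T' i = rowsz T i + (g v && (i == K v))) &
      legal (mu v) (lev T v) (u v) (K v) (g v)].
    move=> /bigW[Vv V2v V3v V4v xv]; have [_ [er ec]] := fin v V2v.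
    rewrite -er in ec; split=> //; last exact: lg.
    by move=> i; rewrite -(top' v) // -(top v) // e' xv.
  have hs v : hstrip (mu v) (lev T v) (u v) by case: ri.
  have rc v : W <= v -> if g v then r = K v /\ c = lev T v (K v)
     else r = (K v).-1 /\ K v = r.+1 /\ c.+1 = lev T v r.
    move=> Wv; have [er ec er' [l1 l2 l3 l4]] := rw v Wv; have [_ _ V3v _ _] := bigW v Wv.
    case: (g v) er er' l4 => /= er er' l4.
      by rewrite subn0 in er; subst r; split=> //; rewrite ec er' eqxx addn1 top.
    have l0 : 0 < K v by lia.
    have e1 : r = (K v).-1 by lia.
    have e2 : K v = r.+1 by lia.
    split=> //; split=> //.
    have := l3 l0; rewrite -e1 l1; last by lia.
    by rewrite ec er' addn0 -(top _ r V3v); lia.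
  have szr i : (if i == r then maxn c.+1 (rowsz Q r) else rowsz Q i) = rowsz T' i.
    have [er ec er' lgW] := rw W (leqnn _); have := rc W (leqnn _); have [_ _ V3v _ _] := WW.
    rewrite !rQ er'; case: (g W) => /= [[e1 e2]|[e1 [e2 e3]]].
      rewrite -e1; case: eqP => [->|]; last by lia.
      by rewrite -e1 top // in e2; lia.
    rewrite addn0; case: eqP => [->|//].
    by rewrite top // in e3; lia.
  split.
  + rewrite size_set_nth; apply/eqP; rewrite eqn_leq sQ.
    have rT' : r < size T' by rewrite increasing_size // -(szr r) eqxx leq_max.
    apply/andP; split.
      rewrite geq_max rT' /= leqNgt increasing_size //; apply/negP => h.
      have : 0 < rowsz T' (size T').
        have [_ _ -> _] := rw W (leqnn _); exact: (leq_trans h (leq_addr _ _)).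
      by rewrite nth_default.
    rewrite leq_max; case: (ltnP (size T) (size T')) => // lt; last by rewrite orbT.
    rewrite orbF; case es : (size T') lt rT' => [|s] // lt rT'.
    have [er ec er' _] := rw W (leqnn _).
    have : 0 < rowsz T' s by rewrite -increasing_size // es.
    rewrite er' nth_default // add0n lt0b => /andP[gW /eqP ->].
    by have := rc W (leqnn _); rewrite gW => -[-> _].
  + by move=> i; rewrite rowsz_set_box_sv szr.
  + exists W => v Wv i d l'; have [er ec er' [l1 l2 l3 l4]] := rw v Wv.
    have [Vv _ V3v V4v xv] := bigW v Wv.
    have [h0 h] := hs v; have [h1 h2 h3 h4 h5] := h i.
    rewrite box_set_box !e' xv /u' xv /=.
    have mQ i0 d0 := memQ v Vv i0 d0 l'.
    case: (eqVneq l' l) mQ => [->|ne] mQ; last first.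
      by case: ifP => // /andP[/eqP -> /eqP ->]; rewrite !inE (negbTE ne) /= mQ.
    have := rc v Wv; case: (g v) l4 => l4 /= => [[e1 e2]|[e1 [e2 e3]]].
      rewrite e1 e2; case: (ltngtP i (K v)) => [lt|gt|eq] /=.
      * by rewrite mQ ?addn0; case: (ltngtP i.+1 (K v)); lia.
      * by rewrite mQ; have := leqW (ltnW gt); lia.
      * rewrite -eq; have -> : (i.+1 == i) = false by lia.
        rewrite leqnSn; case: eqP => [->|dn]; first by rewrite !inE eqxx; lia.
        by rewrite mQ; lia.
    have ur : u v r = lev T v r by apply: l2; lia.
    have ur1 : u v r.+1 = lev T v r.+1 by apply: l2; lia.
    have lr : lev T v r.+1 < lev T v r.
      by have := l3 ltac:(lia); rewrite -e1 -e2 l1 //; lia.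
    rewrite !addn0 e2; case: (ltngtP i r) => [lt|gt|eq] /=.
    * by rewrite mQ; lia.
    * by rewrite mQ; lia.
    * by rewrite eq; case: eqP => [->|dn]; rewrite ?inE ?eqxx ?mQ; lia.
- move=> k k0 v; rewrite /u'; case: (ltnP x v) => // xv; congr (_ + _).
  rewrite leqNgt; case: ltnP => // kK; have [_ _ l3 _] := lg v xv.
  by have := l3 ltac:(lia); rewrite k0 //; lia.
Qed.

Lemma row_insertion n T (Q : svtableau n) l A : increasing T ->
  size Q = size T -> (forall i, rowsz Q i = rowsz T i) ->
  (forall i c, l \notin box Q i c) -> sorted (fun x y => y < x) A ->
  let TQ := foldl (@hecke_step n) (T, Q) (zip A (nseq (size A) l)) in
  exists u, [/\ increasing TQ.1, row_ins (lev T) (lev TQ.1) u,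
    records l Q TQ.2 TQ.1 u &
    forall k, (forall v i, k <= i -> lev T v i = 0) ->
    forall v, u v k = count (fun y => y < v) A].
Proof.
move=> inc sQ rQ lQ srt.
(* [(head 0 A).+1] serves as a fictitious letter inserted before the first one. *)
have rs : insertion_state (lev T) T (lev T) (head 0 A).+1.
  by split=> //; apply: row_ins_refl; apply: lev_strict_levels.
have qs : records l Q Q T (lev T).
  split=> //; exists 0 => v _ i c l'; case: eqP => // ->.
  by rewrite (negbTE (lQ i c)); lia.
have pth : path (fun x y => y < x) (head 0 A).+1 A.
  by case: A srt {rs} => //= a A ->; rewrite ltnSn.
suff {lQ sQ rQ srt rs qs pth} main : forall mu T1 Q1 u b,
    insertion_state mu T1 u b -> records l Q Q1 T1 u ->
    path (fun x y => y < x) b A ->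
    let TQ := foldl (@hecke_step n) (T1, Q1) (zip A (nseq (size A) l)) in
    exists u', [/\ increasing TQ.1, row_ins mu (lev TQ.1) u', records l Q TQ.2 TQ.1 u' &
      forall k, (forall v i, k <= i -> mu v i = 0) ->
      forall v, u' v k = u v k + count (fun y => y < v) A].
  have [u [h1 h2 h3 h4]] := main _ _ _ _ _ rs qs pth.
  by exists u; split=> // k k0 v; rewrite h4 // k0.
elim: A => [|x A IH] mu T1 Q1 u b rs qs /=.
  by exists u; case: rs => h1 h2 _; split=> // k _ v; rewrite addn0.
move=> /andP[xb pth]; have [u' [rs' qs' e]] := hecke_step_row rs xb qs.
move: rs' qs'; case: (hecke_step _ _) => T2 Q2 /= rs' qs'.
have [u2 [h1 h2 h3 h4]] := IH _ _ _ _ _ rs' qs' pth.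
by exists u2; split=> // k k0 v; rewrite h4 // e // addnA.
Qed.

(** * Crystal operators *)

(** Since h drops by one along g, it separates the iterates of x; therefore [h x < #|V|], and the
    bounded maximum attains the full string length. *)
Lemma string_lengthE (V : finType) (g : V -> option V) (h : V -> nat) :
  (forall x, if g x is Some y then h x = (h y).+1 else h x = 0) ->
  string_length g =1 h.
Proof.
move=> hg x.
have it k y : iter k (obind g) (Some y) != None -> 
    k <= h y /\ (forall z, iter k (obind g) (Some y) = Some z -> h z = h y - k).
  elim: k => [|k IH] /=; first by split=> // z [<-]; rewrite subn0.
  case E : (iter k _ _) IH => [z|] //= /(_ isT) [ky /(_ z erefl) hz].
  by have := hg z; case: (g z) => // w e _; split=> [|_ [<-]]; lia.
have some k y : k <= h y -> iter k (obind g) (Some y) != None.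
  elim: k => // k IH kh /=; have nn := IH (ltnW kh).
  have := it k y nn; case: (iter k _ _) nn => //= z _ [_ /(_ z erefl) hz].
  by have := hg z; case: (g z) => // z0; exfalso; lia.
have hx : h x < #|V|.
  pose f (k : 'I_(h x).+1) := odflt x (iter k (obind g) (Some x)).
  rewrite -[(h x).+1]card_ord; rewrite -(card_image (f := f)) ?max_card // => i j.
  have hf (k : 'I_(h x).+1) : h (f k) = h x - k.
    have := some k x (ltn_ord k); rewrite /f; move: (it k x).
    by case: (iter k _ _) => //= z /(_ isT) [_ /(_ z erefl)].
  move=> e; apply: ord_inj; have := hf i; rewrite e hf.
  by have := ltn_ord i; have := ltn_ord j; lia.
apply/eqP; rewrite eqn_leq; apply/andP; split.
  by apply/bigmax_leqP => k /it[].
exact: (@leq_bigmax_cond _ _ _ (Ordinal hx) (some _ _ (leqnn _))).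
Qed.

(** Closed forms for the string lengths travel together with the inverse relation of e and f, so the
    tensor rule can be evaluated without returning to [string_length]. *)
Definition seminormal I (V : finType) (C : crystal I V) i (eps phi : V -> nat) :=
  forall x,
    (if cry_e C i x is Some y
     then [/\ eps x = (eps y).+1, phi y = (phi x).+1 & cry_f C i y = Some x]
     else eps x = 0) /\
    (if cry_f C i x is Some y then phi x = (phi y).+1 /\ cry_e C i y = Some x
     else phi x = 0).

Lemma seminormal_eps I V (C : crystal I V) i eps phi :
  seminormal C i eps phi -> cry_eps C i =1 eps.
Proof.
move=> sn; apply: string_lengthE => x; have [] := sn x.
by case: (cry_e C i x) => // y [].
Qed.

Lemma seminormal_phi I V (C : crystal I V) i eps phi :
  seminormal C i eps phi -> cry_phi C i =1 phi.
Proof.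
move=> sn; apply: string_lengthE => x; have [_] := sn x.
by case: (cry_f C i x) => // y [].
Qed.

Lemma tensor_seminormal I (V W : finType) (C : crystal I V) (D : crystal I W) i
    eps1 phi1 eps2 phi2 :
  seminormal C i eps1 phi1 -> seminormal D i eps2 phi2 ->
  seminormal (tensor C D) i (fun x => eps2 x.2 + (eps1 x.1 - phi2 x.2))
                            (fun x => phi1 x.1 + (phi2 x.2 - eps1 x.1)).
Proof.
move=> sC sD [b c] /=.
have ep := seminormal_phi sD; have ee := seminormal_eps sC.
rewrite !ee !ep; split.
  case: leqP => cmp.
    have := (sD c).1; case: (cry_e D i c) => [c'|] /=; last by lia.
    move=> [e1 e2 e3]; rewrite !ee !ep e2 ltnS cmp e3 /=.
    by split=> //; lia.
  have := (sC b).1; case: (cry_e C i b) => [b'|] /=; last by lia.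
  move=> [e1 e2 e3]; rewrite !ee !ep e2 e3 ltnNge -ltnS -e1 cmp /=.
  by split=> //; lia.
case: ltnP => cmp.
  have := (sD c).2; case: (cry_f D i c) => [c'|] /=; last by lia.
  move=> [e1 e2]; rewrite !ee !ep e2 -ltnS -e1 cmp /=.
  by split=> //; lia.
have := (sC b).2; case: (cry_f C i b) => [b'|] /=; last by lia.
move=> [e1 e2]; have := (sC b').1; rewrite e2 => -[e3 e4 _].
rewrite !ee !ep e3 leqNgt ltnS cmp /=.
by split=> //; lia.
Qed.

Lemma seminormal_iter_e I V (C : crystal I V) i eps phi k x :
  seminormal C i eps phi -> k <= eps x ->
  exists2 y, iter k (obind (cry_e C i)) (Some x) = Some y & eps y = eps x - k /\ phi y = phi x + k.
Proof.
move=> sn; elim: k => [|k IH] kx; first by exists x; rewrite ?subn0 ?addn0.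
have [y e [ey py]] := IH (ltnW kx).
have := (sn y).1; rewrite /= e /=.
case: (cry_e C i y) => [z [e1 e2 _]|]; last by lia.
by exists z => //; lia.
Qed.

(** As long as eps of the left factor exceeds [phi2 c], the tensor rule sends e_i to the left. The
    excess is exactly [eps1 b - phi2 c]; once it is used up, [tensor_reaches_right] applies. *)
Lemma tensor_reaches_left I (V W : finType) (C : crystal I V) (D : crystal I W) i
    eps1 phi1 eps2 phi2 k b b' c :
  seminormal C i eps1 phi1 -> seminormal D i eps2 phi2 ->
  k <= eps1 b - phi2 c ->
  iter k (obind (cry_e C i)) (Some b) = Some b' ->
  iter k (obind (cry_e (tensor C D) i)) (Some (b, c)) = Some (b', c).
Proof.
move=> sC sD; have ep := seminormal_phi sD; have ee := seminormal_eps sC.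
elim: k b' => [|k IH] b' /= kb; first by move=> [<-].
have [b1 e [e1 e2]] := seminormal_iter_e (k := k) (x := b) sC ltac:(lia).
rewrite e (IH _ _ e) /=; last by lia.
rewrite ee ep; case: leqP => cmp; first by lia.
by move=> ->.
Qed.

Lemma tensor_reaches_right I (V W : finType) (C : crystal I V) (D : crystal I W) i
    eps1 phi1 eps2 phi2 k b c c' :
  seminormal C i eps1 phi1 -> seminormal D i eps2 phi2 ->
  eps1 b <= phi2 c ->
  iter k (obind (cry_e D i)) (Some c) = Some c' ->
  iter k (obind (cry_e (tensor C D) i)) (Some (b, c)) = Some (b, c').
Proof.
move=> sC sD bc; have ep := seminormal_phi sD; have ee := seminormal_eps sC.
elim: k c' => [|k IH] c' /=; first by move=> [<-].
case E : (iter k (obind (cry_e D i)) (Some c)) => [c1|] //= e.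
rewrite (IH _ E) /= ee ep.
have h : phi2 c <= phi2 c1.
  elim: k c1 E {IH e} => [|k IH] c1 /=; first by move=> [<-].
  case E : (iter k _ _) => [c2|] //= e; have := (sD c2).1; rewrite e => -[_ -> _].
  by apply: leqW; apply: IH.
by rewrite (leq_trans bc h) e.
Qed.

Section SetCrystal.
Context (n : nat) (i : 'I_n.-1).
Let a := this_ord i.
Let b := next_ord i.

Lemma this_next : a == b = false.
Proof. by apply/negbTE; rewrite -val_eqE /= ltn_eqF. Qed.

(** Nontrivial i-strings have length 2: f_i leads from {i} through {i, i + 1} to {i + 1}, other
    elements being fixed. *)
Definition set_eps (T : {set 'I_n}) := if b \in T then if a \in T then 1 else 2 else 0.
Definition set_phi (T : {set 'I_n}) := if a \in T then if b \in T then 1 else 2 else 0.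

Lemma set_tests (T : {set 'I_n}) :
  [/\ (T :&: [set a; b] == [set b]) = (a \notin T) && (b \in T),
      (T :&: [set a; b] == [set a]) = (a \in T) && (b \notin T) &
      (T :&: [set a; b] == [set a; b]) = (a \in T) && (b \in T)].
Proof.
have ab := this_next; have ba : b == a = false by rewrite eq_sym.
split; apply/eqP/andP => [/setP h|[h1 h2]].
- by have := h a; have := h b; rewrite !inE ?eqxx ?ab ?ba ?orbT ?andbT => -> ->.
- apply/setP => x; rewrite !inE; case: (eqVneq x a) => [->|_] /=; last first.
    by case: eqP => [->|]; rewrite ?h2 ?andbF.
  by rewrite ab (negbTE h1).
- by have := h a; have := h b; rewrite !inE ?eqxx ?ab ?ba ?orbT ?andbT => -> ->.
- apply/setP => x; rewrite !inE; case: (eqVneq x a) => [->|_] /=; first by rewrite h1.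
  by case: eqP => [->|]; rewrite ?(negbTE h2) ?andbF.
- by have := h a; have := h b; rewrite !inE ?eqxx ?ab ?ba ?orbT ?andbT => -> ->.
- apply/setP => x; rewrite !inE; case: (eqVneq x a) => [->|_] /=; first by rewrite h1.
  by case: eqP => [->|]; rewrite ?h2 ?andbF.
Qed.

Lemma set_crystal_seminormal : seminormal (set_crystal n) i set_eps set_phi.
Proof.
move=> T; rewrite /= -/a -/b; have ab := this_next.
have ba : b == a = false by rewrite eq_sym.
have [t1 t2 t3] := set_tests T; rewrite t1 t2 t3 /set_eps /set_phi.
case aT : (a \in T); case bT : (b \in T) => /=.
- have [s1 s2 s3] := set_tests (T :\ b); have [r1 r2 r3] := set_tests (T :\ a).
  rewrite s2 s3 r1 !inE ?eqxx ?ab ?ba ?aT ?bT /=.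
  by rewrite !finset.setD1K.
- have [s1 s2 s3] := set_tests (b |: T).
  rewrite s1 s3 !inE ?eqxx ?ab ?ba ?aT ?bT /=.
  by rewrite finset.setU1K ?bT.
- have [s1 s2 s3] := set_tests (a |: T).
  rewrite s2 s3 !inE ?eqxx ?ab ?ba ?aT ?bT /=.
  by rewrite finset.setU1K ?aT.
- by [].
Qed.

End SetCrystal.

(** Functional form of [sig_step]: r and t tell whether the current set contains i and i + 1, f is
    phi_i of the tensor factors to its right, and the result is the set after e_i has acted eps_i -
    f times (not at all if eps_i <= f). *)
Lemma sig_step_bits x y p q (r t p' q' : bool) :
  y + q <= x + p ->
  sig_step x y p q (x + r) (y + t) (p + p') (q + q') ->
  let f := x + p - (y + q) in
  (p', q') = (if ~~ t then (r, false) else if f == 0 then (true, false)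
              else if f == 1 then (true, true) else (r, true)).
Proof.
move=> le sg f; case: t sg => /= sg.
  case: eqP => f0; last case: eqP => f1.
  - by case: r p' q' sg => [] [] [] //= [] []; lia.
  - by case: r p' q' sg => [] [] [] //= [] []; lia.
  - by case: r p' q' sg => [] [] [] //= [] []; lia.
by case: r p' q' sg => [] [] [] //= [] []; lia.
Qed.

Section SetSig.
Context (n : nat) (i : 'I_n.-1) (T T' : {set 'I_n}).
Let a := this_ord i.
Let b := next_ord i.

Lemma set_crystal_rectify x y p q :
  y + q <= x + p ->
  sig_step x y p q (x + (a \in T)) (y + (b \in T)) (p + (a \in T')) (q + (b \in T')) ->
  (forall c, c != a -> c != b -> (c \in T') = (c \in T)) ->
  iter (set_eps i T - (x + p - (y + q))) (obind (cry_e (set_crystal n) i)) (Some T) = Some T'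
  /\ set_phi i T + (x + p - (y + q) - set_eps i T) + (y + (b \in T) + (q + (b \in T')))
     = x + (a \in T) + (p + (a \in T')).
Proof.
move=> le /(sig_step_bits le) /= sg oth; have ab : a == b = false := this_next i.
have ba : b == a = false by rewrite eq_sym.
have xpE : x + p = x + p - (y + q) + (y + q) by rewrite subnK.
have eT (U : {set _}) : (a \in U) = (a \in T') -> (b \in U) = (b \in T') ->
    (forall c, c != a -> c != b -> (c \in U) = (c \in T)) -> U = T'.
  move=> h1 h2 h3; apply/setP => c; case: (eqVneq c a) => [->//|ca].
  by case: (eqVneq c b) => [->//|cb]; rewrite h3 // oth.
have [t1 _ t3] := set_tests i T; have [s1 _ s3] := set_tests i (a |: T).
rewrite -/a -/b !inE ?eqxx ?ab ?ba /= in t1 t3 s1 s3.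
move: (x + p - (y + q)) xpE sg => f xpE.
rewrite /set_eps /set_phi -/a -/b.
case bT : (b \in T) t1 t3 s1 s3; last first.
  move=> _ _ _ _ /= [aT' bT']; split; last by rewrite aT' bT'; case: (a \in T); lia.
  by congr Some; apply: eT; rewrite ?aT' ?bT' ?bT.
case aT : (a \in T) => /= t1 t3 s1 s3.
  case: (posnP f) xpE => [-> xpE [aT' bT']|f0 xpE].
    rewrite aT' bT'; split; last by lia.
    rewrite /= -/a -/b t1 t3; congr Some; apply: eT; rewrite ?inE ?aT ?aT' ?bT' ?eqxx ?ab //.
    by move=> c ca cb; rewrite !inE cb.
  have -> : 1 - f = 0 by lia.
  rewrite /= if_same => -[aT' bT']; rewrite aT' bT'; split; last by lia.
  by congr Some; apply: eT; rewrite ?aT ?bT ?aT' ?bT'.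
case: (posnP f) xpE => [-> xpE [aT' bT']|f0 xpE].
  rewrite aT' bT'; split; last by lia.
  rewrite /= -/a -/b t1 /= -/a -/b s1 s3 ?bT /=.
  congr Some; apply: eT; rewrite ?inE ?bT ?aT' ?bT' ?eqxx ?ab ?orbT //.
  by move=> c ca cb; rewrite !inE cb (negbTE ca).
rewrite /=; case: eqP xpE => [-> xpE [aT' bT']|f1 xpE [aT' bT']].
  rewrite aT' bT'; split; last by lia.
  rewrite /= -/a -/b t1.
  congr Some; apply: eT; rewrite ?inE ?bT ?aT' ?bT' ?eqxx ?ab ?orbT //.
  by move=> c ca cb; rewrite !inE (negbTE ca).
have -> : 2 - f = 0 by lia.
rewrite aT' bT'; split; last by lia.
by congr Some; apply: eT; rewrite ?aT ?bT ?aT' ?bT'.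
Qed.
End SetSig.

Fixpoint svw_phi n i m : SVW n m -> nat :=
  if m is m'.+1 then fun S => set_phi i (thead S) + 
     (svw_phi i (behead_tuple S) - set_eps i (thead S))
  else fun _ => 0.

Fixpoint svw_eps n i m : SVW n m -> nat :=
  if m is m'.+1 then fun S => svw_eps i (behead_tuple S) +
     (set_eps i (thead S) - svw_phi i (behead_tuple S))
  else fun _ => 0.

Lemma transport_seminormal I (V W : finType) (h : V -> W) (h' : W -> V)
    (C : crystal I V) i eps phi :
  cancel h h' -> cancel h' h -> seminormal C i eps phi ->
  seminormal (transport h h' C) i (eps \o h') (phi \o h').
Proof.
move=> hK h'K sC x /=; have [h1 h2] := sC (h' x); split.
  by case: (cry_e C i (h' x)) h1 => //= y [-> e2 e3]; rewrite hK e2 e3 /= h'K.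
by case: (cry_f C i (h' x)) h2 => //= y [-> e2]; rewrite hK e2 /= h'K.
Qed.

Lemma cons_thead A m (S : m.+1.-tuple A) : cons_tuple (thead S) (behead_tuple S) = S.
Proof. by rewrite [RHS]tuple_eta; apply: val_inj. Qed.

Lemma svw_seminormal n m i :
  seminormal (svw_crystal n m) i (@svw_eps n i m) (@svw_phi n i m).
Proof.
elim: m => [|m IH] //=.
have st := tensor_seminormal (set_crystal_seminormal i) IH.
apply: transport_seminormal st.
  by move=> [T S] /=; rewrite theadE; congr pair; apply: val_inj.
exact: cons_thead.
Qed.

Lemma iter_transport I (V W : finType) (h : V -> W) (h' : W -> V)
    (C : crystal I V) i k x y :
  cancel h h' -> iter k (obind (cry_e C i)) (Some x) = Some y ->
  iter k (obind (cry_e (transport h h' C) i)) (Some (h x)) = Some (h y).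
Proof.
move=> hK; elim: k y => [|k IH] y /=; first by move=> [->].
case E : (iter k _ _) => [z|] //= e.
by rewrite (IH _ E) /= hK e.
Qed.

Lemma tnth_behead_lift A m (S : m.+1.-tuple A) j :
  tnth (behead_tuple S) j = tnth S (lift ord0 j).
Proof. by rewrite !(tnth_nth (thead S)) /= nth_behead. Qed.

(** Position j carries the letter m - j, so the letters below v are the last tensor factors, and
    raising the level puts one more factor in front. Induction on m thus runs through the levels,
    with the second conclusion supplying phi of the tail. *)
Lemma svw_rectify n m (i : 'I_n.-1) (S S' : SVW n m) (x y p q : nat -> nat) :
  let a := this_ord i in let b := next_ord i in
  (forall v, y v + q v <= x v + p v) ->
  (forall v, sig_step (x v) (y v) (p v) (q v) (x v.+1) (y v.+1) (p v.+1) (q v.+1)) ->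
  [/\ x 1 = 0, y 1 = 0, p 1 = 0 & q 1 = 0] ->
  (forall j : 'I_m, [/\ x (m - j).+1 = x (m - j) + (a \in tnth S j),
                 y (m - j).+1 = y (m - j) + (b \in tnth S j),
                 p (m - j).+1 = p (m - j) + (a \in tnth S' j) &
                 q (m - j).+1 = q (m - j) + (b \in tnth S' j)]) ->
  (forall (j : 'I_m) c, c != a -> c != b -> (c \in tnth S' j) = (c \in tnth S j)) ->
  iter (svw_eps i S) (obind (cry_e (svw_crystal n m) i)) (Some S) = Some S' /\
  svw_phi i S + (y m.+1 + q m.+1) = x m.+1 + p m.+1.
Proof.
move=> a b le sg [x1 y1 p1 q1].
elim: m S S' => [|m IH] S S' bits oth.
  by rewrite (tuple0 S) (tuple0 S') /= x1 y1 p1 q1.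
have [] := IH (behead_tuple S) (behead_tuple S').
- by move=> j; rewrite !tnth_behead_lift -subSS; exact: (bits (lift ord0 j)).
- by move=> j c ca cb; rewrite !tnth_behead_lift oth.
move=> it ph.
have [b1 b2 b3 b4] := bits ord0; rewrite subn0 in b1 b2 b3 b4.
have := sg m.+1; rewrite b1 b2 b3 b4 => sgm.
have [it2 ph2] := set_crystal_rectify (le m.+1) sgm (oth ord0).
have f : x m.+1 + p m.+1 - (y m.+1 + q m.+1) = svw_phi i (behead_tuple S).
  by rewrite -ph addnK.
rewrite f in it2 ph2; split=> /=; last exact: ph2.
have sD := @svw_seminormal n m i; have sC := set_crystal_seminormal i.
have it3 := tensor_reaches_left sC sD (leqnn _) it2.
(* The first factor has used up its excess over phi of the tail, so all further operators act on the
   tail. *)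
have e1 : set_eps i (thead S') <= svw_phi i (behead_tuple S).
  have [z ez [e2 _]] := seminormal_iter_e sC
    (leq_subr (svw_phi i (behead_tuple S)) (set_eps i (thead S))).
  by move: it2; rewrite ez => -[ez']; rewrite [thead S']/thead -ez' e2 leq_subCl.
have it4 := tensor_reaches_right sC sD e1 it.
have it5 : iter (svw_eps i (behead_tuple S) + (set_eps i (thead S) - svw_phi i (behead_tuple S)))
   (obind (cry_e (tensor (set_crystal n) (svw_crystal n m)) i)) (Some (thead S, behead_tuple S))
   = Some (thead S', behead_tuple S').
  by rewrite iterD it3 it4.
have := iter_transport (h := fun x => cons_tuple x.1 x.2)
  (h' := fun S => (thead S, behead_tuple S)) _ it5.
rewrite /= !cons_thead; apply.
by move=> [T U] /=; rewrite theadE; congr pair; apply: val_inj.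
Qed.

(** * Words and their rows *)

Lemma gtn_transitive : transitive (fun x y : nat => y < x).
Proof. by move=> x y z h1 h2; apply: ltn_trans h2 h1. Qed.

Lemma mem_A_word_at n m (S : SVW n m) i (j : 'I_m) :
  (m - j \in A_word_at S i) = (i \in tnth S j).
Proof.
apply/mapP/idP => [[j2]|h]; last by exists j; rewrite // mem_filter h mem_enum.
rewrite mem_filter => /andP[h _] e; suff -> : j = j2 by [].
by apply: ord_inj; have := ltn_ord j; have := ltn_ord j2; lia.
Qed.

Lemma A_word_at_range n m (S : SVW n m) i v : v \in A_word_at S i -> 0 < v <= m.
Proof. by case/mapP => j _ ->; have := ltn_ord j; lia. Qed.

Lemma A_word_at_sorted n m (S : SVW n m) i : sorted (fun x y => y < x) (A_word_at S i).
Proof.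
rewrite sorted_map; apply: sorted_filter.
  by move=> x y z; exact: gtn_transitive.
have : sorted ltn (map val (enum 'I_m)) by rewrite val_enum_ord iota_ltn_sorted.
rewrite sorted_map; apply: sub_sorted => x y /=.
by have := ltn_ord x; have := ltn_ord y; lia.
Qed.

Lemma A_word_at_uniq n m (S : SVW n m) i : uniq (A_word_at S i).
Proof.
by apply: (sorted_uniq gtn_transitive) (A_word_at_sorted S i) => x; rewrite ltnn.
Qed.

Definition word_lev n m (S : SVW n m) (i : 'I_n) v := count (fun y => y < v) (A_word_at S i).

Lemma word_levS n m (S : SVW n m) i v :
  word_lev S i v.+1 = word_lev S i v + (v \in A_word_at S i).
Proof. by rewrite /word_lev count_ltnS count_uniq_mem // A_word_at_uniq. Qed.

Lemma word_lev_bit n m (S : SVW n m) i (j : 'I_m) :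
  word_lev S i (m - j).+1 = word_lev S i (m - j) + (i \in tnth S j).
Proof. by rewrite word_levS mem_A_word_at. Qed.

Lemma word_lev_low n m (S : SVW n m) i v : v <= 1 -> word_lev S i v = 0.
Proof.
move=> v1; apply/eqP; rewrite -leqn0 leqNgt -has_count; apply/hasPn => y.
by move/A_word_at_range; lia.
Qed.

Lemma word_lev_high n m (S : SVW n m) i v : m < v -> word_lev S i v.+1 = word_lev S i v.
Proof.
move=> mv; rewrite word_levS; case: (boolP (v \in _)) => [/A_word_at_range|_]; lia.
Qed.

Definition svw_of n m (f : nat -> nat -> nat) : SVW n m :=
  [tuple [set i : 'I_n | f i (m - j) < f i (m - j).+1] | j < m].

Lemma word_lev_svw_of n m (f : nat -> nat -> nat) (i : 'I_n) :
  f i 1 = 0 -> (forall v, f i v <= f i v.+1 /\ f i v.+1 <= (f i v).+1) ->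
  (forall v, m < v -> f i v.+1 = f i v) ->
  forall v, word_lev (svw_of n m f) i v = f i v.
Proof.
move=> f1 inc hi; elim=> [|v IH].
  by rewrite word_lev_low //; have := inc 0; lia.
rewrite word_levS IH; have := inc v.
case: (posnP v) => [->|v0].
  case: (boolP (0 \in _)) => [/A_word_at_range//|_]; have := inc 0; lia.
case: (leqP v m) => vm; last first.
  by rewrite hi //; case: (boolP (v \in _)) => [/A_word_at_range|_]; lia.
have jm : m - v < m by lia.
have ev : v = m - Ordinal jm by rewrite /=; lia.
by have := mem_A_word_at (svw_of n m f) i (Ordinal jm); rewrite -ev => ->;
  rewrite tnth_mktuple inE -ev; lia.
Qed.

Lemma svw_eq_lev n m (S S' : SVW n m) :
  (forall i v, word_lev S i v = word_lev S' i v) -> S = S'.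
Proof.
move=> e; apply: eq_from_tnth => j; apply/setP => i.
by have := word_lev_bit S i j; have := word_lev_bit S' i j; rewrite !e; lia.
Qed.

Lemma nth_trim_rows A (T : tableau A) i : row (trim_rows T) i = row T i.
Proof.
elim: T i => [|r T IH] i //=; case: andP => [[/nilP r0 /nilP t0]|_].
  rewrite t0 in IH; case: i => [|i] /=; [by rewrite r0|by rewrite -IH nth_nil].
by case: i => [|i] /=.
Qed.

Lemma trim_rows_eq A (T P : tableau A) :
  (forall i, row T i = row P i) -> (forall i, i < size P -> 0 < rowsz P i) ->
  trim_rows T = P.
Proof.
elim: T P => [|r T IH] [|p P] //= e nP.
- by have := nP 0 isT; rewrite -(e 0).
- have -> : trim_rows T = [::].
    by apply: IH => // i; have := e i.+1; rewrite /= nth_nil.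
  by rewrite (e 0 : r = [::]).
- have -> : trim_rows T = P.
    by apply: IH => [i|i iP]; [exact: (e i.+1)|exact: (nP i.+1)].
  have /= -> := e 0; have /= := nP 0 isT.
  by case: p {e nP}.
Qed.

Lemma row_tab n m (S : SVW n m) (i : 'I_n) : row (tab S) i = rev (A_word_at S i).
Proof.
by rewrite nth_trim_rows (nth_map i) ?size_enum_ord // nth_ord_enum.
Qed.

Lemma row_tab_default n m (S : SVW n m) i : n <= i -> row (tab S) i = [::].
Proof. by move=> ni; rewrite nth_trim_rows nth_default // size_map size_enum_ord. Qed.

Lemma lev_tab n m (S : SVW n m) v (i : 'I_n) : lev (tab S) v i = word_lev S i v.
Proof. by rewrite /lev row_tab count_rev. Qed.

Lemma tab_inj n m (S S' : SVW n m) : tab S = tab S' -> S = S'.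
Proof. by move=> e; apply: svw_eq_lev => i v; rewrite -!lev_tab e. Qed.

Lemma tab_eq n m (S : SVW n m) P : increasing P ->
  (forall v i, n <= i -> lev P v i = 0) ->
  (forall v (i : 'I_n), word_lev S i v = lev P v i) -> tab S = P.
Proof.
move=> inc hi lo; apply: trim_rows_eq; last by case/increasingP: inc.
move=> i; case: (ltnP i n) => ni; last first.
  rewrite nth_default; last by rewrite size_map size_enum_ord.
  have [V h] := lev_rowsz P; apply/esym/size0nil.
  by rewrite -(h V) // hi.
rewrite (nth_map (Ordinal ni)) ?size_enum_ord //.
rewrite (_ : nth _ _ i = Ordinal ni); last first.
  by apply: ord_inj; rewrite nth_enum_ord.
apply: (irr_sorted_eq ltn_trans ltnn) _ (row_sorted i inc) _.
  by rewrite rev_sorted; exact: A_word_at_sorted.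
move=> y; rewrite mem_rev; have := word_levS S (Ordinal ni) y.
rewrite !lo /lev count_ltnS count_uniq_mem //=; first by lia.
exact: (sorted_uniq ltn_trans ltnn (row_sorted i inc)).
Qed.

(** * Inserting all rows *)

(** A value absent from the old tableau and from the inserted row appears at no stage of the sweep.
    This confines all entries to 1, ..., m. *)
Lemma row_ins_const mu la u K v :
  row_ins mu la u -> (forall v i, K <= i -> mu v i = 0) ->
  mu v.+1 =1 mu v -> u v.+1 K = u v K ->
  la v.+1 =1 la v /\ u v.+1 =1 u v.
Proof.
move=> R mu0 em eu; have ab w := row_ins_above R (mu0 w).
case: R => _ _ hs ls.
have key i : i <= K -> u v.+1 i = u v i /\ la v.+1 i.+1 = la v i.+1.
  move=> iK; rewrite -(subKn iK); elim: (K - i) => [|d [IH1 IH2]].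
    by rewrite subn0 (ab v.+1 K.+1).1 // (ab v K.+1).1.
  case: (leqP K d) => Kd; first by have -> : K - d.+1 = K - d by lia.
  have e : K - d = (K - d.+1).+1 by lia.
  move: IH1; rewrite e; move: (K - d.+1) => j e1.
  by have := em j; case: ((ls v).2 j) => -[]; lia.
split=> i.
  case: i => [|i]; first by have [<- _] := hs v.+1; have [<- _] := hs v; case: (key 0).
  case: (leqP i K) => iK; first by case: (key i iK).
  by rewrite !(ab _ i.+1).1 //; lia.
case: (leqP i K) => iK; first by case: (key i iK).
by rewrite (ab v.+1 i).2 ?(ab v i).2 //; lia.
Qed.

Lemma foldl_zip_flatten A B C (I : Type) (f : C -> A * B -> C)
    (a : I -> seq A) (b : I -> seq B) z s :
  (forall i, size (a i) = size (b i)) ->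
  foldl f z (zip (flatten (map a s)) (flatten (map b s))) =
  foldl (fun z i => foldl f z (zip (a i) (b i))) z s.
Proof.
move=> sz; elim: s z => //= i s IH z.
by rewrite zip_cat // foldl_cat IH.
Qed.

Definition hecke_row n m (S : SVW n m) (PQ : tableau nat * svtableau n) (i : 'I_n) :=
  foldl (@hecke_step n) PQ (zip (A_word_at S i) (nseq (size (A_word_at S i)) i)).

Definition hecke_rows n m (S : SVW n m) k :=
  foldl (hecke_row S) ([::], [::]) (take k (enum 'I_n)).

Lemma hecke_rows_all n m (S : SVW n m) : hecke_rows S n = hecke S.
Proof.
rewrite /hecke_rows take_oversize ?size_enum_ord //.
by rewrite /hecke foldl_zip_flatten // => i; rewrite size_nseq.
Qed.

Lemma hecke_rowsS n m (S : SVW n m) (k : 'I_n) :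
  hecke_rows S k.+1 = hecke_row S (hecke_rows S k) k.
Proof.
rewrite /hecke_rows (take_nth k) ?size_enum_ord // foldl_rcons.
by rewrite nth_ord_enum.
Qed.

(** Neighbouring boxes are compared label by label instead of through all selections; this form is
    stable under adding a strip of new labels. *)
Record partial_sv n (k : nat) (Q : svtableau n) := PartialSv {
  sv_lt : forall i c l, l \in box Q i c -> l < k;
  sv_neq0 : forall i c, c < rowsz Q i -> exists l, l \in box Q i c;
  sv_row : forall i c l l', l \in box Q i c -> l' \in box Q i c.+1 -> l <= l';
  sv_col : forall i c l l', l \in box Q i c -> l' \in box Q i.+1 c -> l < l'
}.

Lemma lt_rowsz_box n (Q : svtableau n) i c l : l \in box Q i c -> c < rowsz Q i.
Proof. by case: (ltnP c (rowsz Q i)) => // h; rewrite nth_default // inE. Qed.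

Record partial_tab m (k : nat) (P : tableau nat) := PartialTab {
  pt_inc : increasing P;
  pt_rows : forall v i, k <= i -> lev P v i = 0;
  pt_low : forall i, lev P 1 i = 0;
  pt_high : forall v i, m < v -> lev P v.+1 i = lev P v i
}.

Lemma hecke_rows_step n m (S : SVW n m) (k : 'I_n) P Q :
  partial_tab m k P -> partial_sv k Q -> size Q = size P ->
  (forall i, rowsz Q i = rowsz P i) ->
  let PQ := hecke_row S (P, Q) k in
  [/\ partial_tab m k.+1 PQ.1, partial_sv k.+1 PQ.2, size PQ.2 = size PQ.1,
      forall i, rowsz PQ.2 i = rowsz PQ.1 i &
  exists u, [/\ row_ins (lev P) (lev PQ.1) u, records k Q PQ.2 PQ.1 u &
      forall v, u v k = word_lev S k v]].
Proof.
move=> pt ps sQ rQ.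
have kQ i c : k \notin box Q i c.
  by apply/negP => /(sv_lt ps); rewrite ltnn.
have := row_insertion (pt_inc pt) sQ rQ kQ (A_word_at_sorted S k).
rewrite /hecke_row; case: (foldl _ _ _) => P1 Q1 /= [u [inc1 ri [s1 r1 [V memQ]] uk]].
have {}uk := uk k (@pt_rows _ _ _ pt).
have cst v := row_ins_const (v := v) ri (@pt_rows _ _ _ pt).
have [l0 _ _ _] := ri; have [_ [l1 _] hs _] := ri.
split=> //; last by exists u; split=> //; split=> //; exists V.
- split=> //.
  + by move=> v i ki; apply: (row_ins_above ri (pt_rows pt v) i).1.
  + move=> i; have e1 j : lev P 1 j = lev P 0 j by rewrite (pt_low pt) l0.1.
    have e2 : u 1 k = u 0 k by rewrite !uk -!/(word_lev S k _) !word_lev_low.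
    by have [-> _] := cst 0 e1 e2.
  + move=> v i mv; have e1 j : lev P v.+1 j = lev P v j by rewrite (pt_high pt).
    have e2 : u v.+1 k = u v k by rewrite !uk -!/(word_lev S k _) word_lev_high.
    by have [-> _] := cst v e1 e2.
- have [V1 top] := lev_rowsz P; have [V2 top1] := lev_rowsz P1.
  pose W := maxn V (maxn V1 V2); have VW : V <= W by rewrite leq_maxl.
  have V1W : V1 <= W by rewrite /W !leq_max leqnn orbT.
  have V2W : V2 <= W by rewrite /W !leq_max leqnn !orbT.
  have mem := memQ W VW; have [h0 h] := hs W.
  have bnd i c l : l \in box Q1 i c -> c < lev P1 W i by move/lt_rowsz_box; rewrite r1 top1.
  have bndQ i c l : l \in box Q i c -> c < lev P W i by move/lt_rowsz_box; rewrite rQ top.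
  split.
  + move=> i c l; rewrite mem; case: eqP => [->//|_ /(sv_lt ps)]; exact: ltnW.
  + move=> i c; rewrite r1 -(top1 _ _ V2W) => ci; have [h1 h2 h3 h4 h5] := h i.
    (* A new box has column at least [lev P W i], and the labels k start there or one column
       earlier. *)
    case: (ltnP c (lev P W i)) => cm; last by exists k; rewrite mem eqxx ci andbT; lia.
    have [l lQ] := sv_neq0 ps (i := i) (c := c) ltac:(by rewrite rQ -(top W)).
    exists l; rewrite mem; case: eqP lQ => // ->; by rewrite (negbTE (kQ _ _)).
  + move=> i c l l'; rewrite !mem; have [h1 h2 h3 h4 h5] := h i.
    case: (eqVneq l k) => [->|lk]; case: (eqVneq l' k) => [->|lk'] //.
    * by move=> /andP[c1 c2] /bndQ; lia.
    * by move=> /(sv_lt ps) /ltnW.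
    * by move=> a b; apply: (sv_row ps a b).
  (* By the last clause of [hstrip], the labels k in row i start at column [lev P1 W i.+1] or later,
     so no box lies below a box containing k. *)
  + move=> i c l l' lc l'c; have := bnd _ _ _ l'c; move: lc l'c.
    rewrite !mem; have [h1 h2 h3 h4 h5] := h i.
    case: (eqVneq l k) => [->|lk]; case: (eqVneq l' k) => [->|lk'] //.
    * by move=> /andP[c1 c2] _; lia.
    * by move=> /andP[c1 c2] _; lia.
    * by move=> /(sv_lt ps).
    * by move=> a b _; apply: (sv_col ps a b).
Qed.

Lemma hecke_rowsP n m (S : SVW n m) k : k <= n ->
  let PQ := hecke_rows S k in
  [/\ partial_tab m k PQ.1, partial_sv k PQ.2, size PQ.2 = size PQ.1 &
      forall i, rowsz PQ.2 i = rowsz PQ.1 i].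
Proof.
elim: k => [|k IH] kn.
  rewrite /hecke_rows take0 /=; split=> //.
    by split=> // *; rewrite /lev nth_nil.
    by split=> [i c l|i c|i c l l'|i c l l']; rewrite ?nth_nil ?inE.
  by move=> i; rewrite !nth_nil.
rewrite (hecke_rowsS S (Ordinal kn)) /=.
have [pt ps sQ rQ] := IH (ltnW kn).
move: pt ps sQ rQ; case: (hecke_rows S k) => P Q /= pt ps sQ rQ.
by have [] := @hecke_rows_step _ _ S (Ordinal kn) P Q pt ps sQ rQ.
Qed.

Lemma hecke_rows_ins n m (S : SVW n m) (k : 'I_n) :
  let PQ := hecke_rows S k in let PQ1 := hecke_rows S k.+1 in
  exists u, [/\ row_ins (lev PQ.1) (lev PQ1.1) u, records k PQ.2 PQ1.2 PQ1.1 u &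
      forall v, u v k = word_lev S k v].
Proof.
rewrite /= hecke_rowsS; have [pt ps sQ rQ] := hecke_rowsP S (ltnW (ltn_ord k)).
move: pt ps sQ rQ; case: (hecke_rows S k) => P Q /= pt ps sQ rQ.
by have [] := @hecke_rows_step _ _ S k P Q pt ps sQ rQ.
Qed.

(** * Joining a word to the highest weight word of its insertion tableau *)

Lemma weakly_connected_sym n m :
  connect_sym (fun S T : SVW n m => crystal_edge S T || crystal_edge T S).
Proof. by apply: sym_connect_sym => S T; rewrite orbC. Qed.

Lemma iter_e_connected n m (i : 'I_n.-1) k (S S' : SVW n m) :
  iter k (obind (cry_e (svw_crystal n m) i)) (Some S) = Some S' -> weakly_connected S S'.
Proof.
elim: k S' => [|k IH] S' /=; first by move=> [->]; apply: connect0.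
case E : (iter k _ _) => [T|] //= e.
apply: connect_trans (IH _ E) _; apply: connect1; apply/orP; right.
apply/existsP; exists i; apply/eqP.
by have := (@svw_seminormal n m i T).1; rewrite e => -[].
Qed.

(** For an increasing tableau the sweep of [svw_rectify] fixes S: applying e_i as often as eps_i(S)
    returns S. The same power brings eps_i down to 0, so eps_i(S) = 0. *)
Lemma increasing_tab_highest_weight n m (S : SVW n m) : increasing (tab S) -> highest_weight S.
Proof.
move=> inc i; have [l0 lr] := lev_strict_levels inc.
have mon := strict_levels_mono (lev_strict_levels inc).
pose L c v := lev (tab S) v c.
have [] := @svw_rectify n m i S S (L i) (L i.+1) (L i) (L i.+1).
- by move=> v; rewrite leq_add // mon.
- by move=> v; have [_] := level_step_refl (lr v) (mon v); apply.
- by have l1 (c : 'I_n) : L c 1 = 0; 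
     [rewrite /L lev_tab word_lev_low|rewrite (l1 (this_ord i)) (l1 (next_ord i))].
- move=> j; rewrite /L !(lev_tab _ _ (this_ord i)) !(lev_tab _ _ (next_ord i)).
  by rewrite !word_lev_bit.
- by [].
move=> it _; have sn := @svw_seminormal n m i.
have [T eT [e0 _]] := seminormal_iter_e sn (leqnn (svw_eps i S)).
move: e0; rewrite subnn; move: eT; rewrite it => -[<-] e0.
by have := (sn S).1; case: (cry_e _ _ _) => // T' [e1]; rewrite e1 in e0.
Qed.

Lemma row_ins_zero mu la u v : row_ins mu la u -> (forall i, la v i = 0) ->
  forall i, u v i = 0.
Proof.
move=> [_ _ hs _] l0; have [h0 h] := hs v.
elim=> [|i IH]; first by rewrite h0 l0.
by have [] := h i; rewrite !l0 IH; lia.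
Qed.

Lemma word_lev_rectify n m (i : 'I_n.-1) (S S' : SVW n m) :
  let a := this_ord i in let b := next_ord i in
  (forall v, word_lev S b v + word_lev S' b v <= word_lev S a v + word_lev S' a v) ->
  (forall v, sig_step (word_lev S a v) (word_lev S b v) (word_lev S' a v) (word_lev S' b v)
     (word_lev S a v.+1) (word_lev S b v.+1) (word_lev S' a v.+1) (word_lev S' b v.+1)) ->
  (forall (c : 'I_n) v, c != a -> c != b -> word_lev S' c v = word_lev S c v) ->
  weakly_connected S S'.
Proof.
move=> a b le sg oth; have [] := @svw_rectify n m i S S' (word_lev S a) (word_lev S b)
  (word_lev S' a) (word_lev S' b) le sg.
- by rewrite !word_lev_low.
- by move=> j; rewrite !word_lev_bit.
- move=> j c ca cb; have := word_lev_bit S c j; have := word_lev_bit S' c j.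
  by rewrite !oth // => ->; move/addnI; case: (c \in _); case: (c \in _).
by move=> it _; apply: iter_e_connected it.
Qed.

Definition rowlev n m (S : SVW n m) (i v : nat) :=
  if insub i is Some c then word_lev S (c : 'I_n) v else 0.

Lemma rowlev_ord n m (S : SVW n m) (i : 'I_n) v : rowlev S i v = word_lev S i v.
Proof. by rewrite /rowlev valK. Qed.

Lemma hecke_rows_insertion n m (S : SVW n m) (k : 'I_n) :
  let P := (hecke_rows S k).1 in let P1 := (hecke_rows S k.+1).1 in
  exists u, [/\ row_ins (lev P) (lev P1) u,
     records k (hecke_rows S k).2 (hecke_rows S k.+1).2 P1 u,
     forall v, u v k = word_lev S k v,
     forall i, u 1 i = 0 & forall v i, m < v -> u v.+1 i = u v i].
Proof.
have [u [ri qs uk]] := hecke_rows_ins S k.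
have [pt _ _ _] := hecke_rowsP S (ltnW (ltn_ord k)).
have [pt1 _ _ _] := hecke_rowsP S (ltn_ord k).
exists u; split=> //; first exact: row_ins_zero ri (pt_low pt1).
move=> v i mv.
have e1 j : lev (hecke_rows S k).1 v.+1 j = lev (hecke_rows S k).1 v j by rewrite (pt_high pt).
have e2 : u v.+1 k = u v k by rewrite !uk word_lev_high.
by have [_ ->] := row_ins_const ri (pt_rows pt) e1 e2.
Qed.

Lemma hecke_rows_connected n m (S : SVW n m) k : k <= n ->
  weakly_connected S
    (svw_of n m (fun i v => if i < k then lev (hecke_rows S k).1 v i else rowlev S i v)).
Proof.
have rl i : [/\ rowlev S i 1 = 0,
     forall v, rowlev S i v <= rowlev S i v.+1 /\ rowlev S i v.+1 <= (rowlev S i v).+1 &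
     forall v, m < v -> rowlev S i v.+1 = rowlev S i v].
  rewrite /rowlev; case: insub => // c; split=> [|v|v].
  - by rewrite word_lev_low.
  - by rewrite word_levS; lia.
  - exact: word_lev_high.
elim: k => [|k IH] kn.
  suff -> : svw_of n m (fun i v => if i < 0 then lev (hecke_rows S 0).1 v i else rowlev S i v) = S.
    exact: connect0.
  apply: svw_eq_lev => i v; have [r1 r2 r3] := rl i.
  by rewrite word_lev_svw_of // rowlev_ord.
apply: connect_trans (IH (ltnW kn)) _.
have [u [ri _ uk u1 uh]] := hecke_rows_insertion S (Ordinal kn).
have [pt _ _ _] := hecke_rowsP S (ltnW kn).
have [pt1 _ _ _] := hecke_rowsP S kn.
rewrite /= in ri uk; move: ri pt pt1 {IH}.
set P := (hecke_rows S k).1; set P1 := (hecke_rows S k.+1).1 => ri pt pt1.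
have [[_ lr] [_ lr1] hs ls] := ri.
(* The word with the moving row at position d: old rows above it, finished rows between it and
   position k, untouched rows of S beyond. Passing from d = c + 1 to d = c replaces rows ([lev P] c,
   [u] c + 1) by ([u] c, [lev P1] c + 1), which is e_c^max. *)
pose F d i v := if i < d then lev P v i else if i == d then u v i
                else if i <= k then lev P1 v i else rowlev S i v.
have good d i : [/\ F d i 1 = 0, forall v, F d i v <= F d i v.+1 /\ F d i v.+1 <= (F d i v).+1 &
    forall v, m < v -> F d i v.+1 = F d i v].
  rewrite /F; case: ifP => _; last (case: ifP => _; last case: ifP => _ //).
  - by split=> [|v|v]; [exact: pt_low pt _|exact: (lr v).1|exact: pt_high pt _ _].
  - by split=> [|v|v]; [exact: u1|exact: (ls v).1|exact: uh].
  - by split=> [|v|v]; [exact: pt_low pt1 _|exact: (lr1 v).1|exact: pt_high pt1 _ _].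
have wl d (i : 'I_n) v : word_lev (svw_of n m (F d)) i v = F d i v.
  by have [g1 g2 g3] := good d i; rewrite word_lev_svw_of.
have start : svw_of n m (fun i v => if i < k then lev P v i else rowlev S i v) = svw_of n m (F k).
  congr svw_of; apply/funext => i; apply/funext => v; rewrite /F.
  case: ltngtP => // ik; subst i; by rewrite (rowlev_ord S (Ordinal kn)) -uk.
have stop : svw_of n m (fun i v => if i < k.+1 then lev P1 v i else rowlev S i v) = svw_of n m (F 0).
  congr svw_of; apply/funext => i; apply/funext => v; rewrite /F ltn0 ltnS.
  by case: eqP => // ->; rewrite leq0n; have [-> _] := hs v.
rewrite start stop.
have : forall d, d <= k -> weakly_connected (svw_of n m (F k)) (svw_of n m (F (k - d))).
  elim=> [|d IH] dk; first by rewrite subn0; apply: connect0.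
  apply: connect_trans (IH (ltnW dk)) _.
  have e : k - d = (k - d.+1).+1 by lia.
  rewrite e; move: (k - d.+1) e => c e; have cn : c < n.-1 by lia.
  apply: (@word_lev_rectify _ _ (Ordinal cn)).
  - move=> v; rewrite !wl /= /F /= ltnSn ltnn eqxx ltnn eqxx ltnNge leqnSn /= gtn_eqF //.
    have -> : c < k by lia.
    by have [] := (hs v).2 c; lia.
  - move=> v; rewrite !wl /= /F /= ltnSn ltnn eqxx ltnn eqxx ltnNge leqnSn /= gtn_eqF //.
    have -> : c < k by lia.
    by have := (ls v).2 c.
  - move=> j v; rewrite -!val_eqE /= !wl /F => jc jc1.
    case: (ltngtP j c) jc => //= [lt|gt] _; first by rewrite ltnS (ltnW lt).
    by rewrite ltnS (leqNgt j c) gt (negbTE jc1).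
by move=> /(_ k (leqnn k)); rewrite subnn.
Qed.

Lemma hecke_connected n m (S : SVW n m) :
  exists2 S', weakly_connected S S' & tab S' = P_hecke S.
Proof.
exists (svw_of n m (fun i v => if i < n then lev (hecke_rows S n).1 v i else rowlev S i v)).
  exact: hecke_rows_connected.
rewrite /P_hecke -hecke_rows_all; have [pt _ _ _] := hecke_rowsP S (leqnn n).
have [_ lr] := lev_strict_levels (pt_inc pt).
apply: tab_eq (pt_inc pt) (pt_rows pt) _ => v i.
rewrite word_lev_svw_of; rewrite ?ltn_ord //.
- exact: pt_low pt _.
- by move=> w; exact: (lr w).1.
- by move=> w; exact: pt_high pt _ _.
Qed.

(** Deleting the label k from the boxes gives the previous recording tableau, hence the old shape.
    The extent of the labels k in each row gives [u] at high levels, starting from [u 0 = la 0].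
    [row_ins_backward] then recovers all levels. *)
Lemma hecke_rows_inj_step n m (S S' : SVW n m) (k : 'I_n) :
  (hecke_rows S k.+1).1 = (hecke_rows S' k.+1).1 ->
  (forall i c, box (hecke_rows S k.+1).2 i c = box (hecke_rows S' k.+1).2 i c) ->
  [/\ (hecke_rows S k).1 = (hecke_rows S' k).1,
      forall i c, box (hecke_rows S k).2 i c = box (hecke_rows S' k).2 i c &
      forall v, word_lev S k v = word_lev S' k v].
Proof.
have [u [ri [_ _ [V mem]] uk _ _]] := hecke_rows_insertion S k.
have [u' [ri' [_ _ [V' mem']] uk' _ _]] := hecke_rows_insertion S' k.
have [pt sv _ rQ] := hecke_rowsP S (ltnW (ltn_ord k)).
have [pt' sv' _ rQ'] := hecke_rowsP S' (ltnW (ltn_ord k)).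
move: ri mem pt sv rQ ri' mem' pt' sv' rQ'.
case: (hecke_rows S k.+1) => P1 Q1; case: (hecke_rows S' k.+1) => P1' Q1' /=.
case: (hecke_rows S k) => P Q; case: (hecke_rows S' k) => P' Q' /=.
move=> ri mem pt sv rQ ri' mem' pt' sv' rQ' eP eQ; subst P1'.
have kQ i c : k \in box Q i c = false by apply/negP => /(sv_lt sv); rewrite ltnn.
have kQ' i c : k \in box Q' i c = false by apply/negP => /(sv_lt sv'); rewrite ltnn.
have boxes i c : box Q i c = box Q' i c.
  apply/setP => l; case: (eqVneq l k) => [->|lk]; first by rewrite kQ kQ'.
  have := mem V (leqnn _) i c l; rewrite (negbTE lk) => <-.
  by have := mem' V' (leqnn _) i c l; rewrite (negbTE lk) eQ.
have rows i : rowsz P i = rowsz P' i.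
  rewrite -rQ -rQ'; apply/eqP; rewrite eqn_leq; apply/andP; split; rewrite leqNgt; apply/negP.
    by move=> /(sv_neq0 sv)[l]; rewrite boxes => /lt_rowsz_box; rewrite ltnn.
  by move=> /(sv_neq0 sv')[l]; rewrite -boxes => /lt_rowsz_box; rewrite ltnn.
have [V1 top] := lev_rowsz P; have [V2 top'] := lev_rowsz P'.
pose W := maxn (maxn V V') (maxn V1 V2).
have bigW v : W <= v -> [/\ V <= v, V' <= v, V1 <= v & V2 <= v].
  by rewrite /W !geq_max => /andP[/andP[-> ->] /andP[-> ->]].
have emu v : W <= v -> lev P v =1 lev P' v.
  by move=> /bigW[_ _ h1 h2] i; rewrite top // top' // rows.
have eu v : W <= v -> u v =1 u' v.
  move=> Wv; have [h1 h2 _ _] := bigW v Wv.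
  have [_ _ hs _] := ri; have [_ _ hs' _] := ri'.
  elim=> [|i IH]; first by have [-> _] := hs v; have [-> _] := hs' v.
  have := fun c => mem v h1 i c k; have := fun c => mem' v h2 i c k.
  rewrite eqxx IH => m1 m2; have := emu v Wv i.
  have [a1 a2 a3 a4 a5] := (hs v).2 i; have [b1 b2 b3 b4 b5] := (hs' v).2 i.
  rewrite IH in a3 a4 a5; move=> e.
  (* If the values differ, the intervals of label k start in different columns; the column where the
     longer one starts separates them. *)
  case: (ltngtP (u v i.+1) (u' v i.+1)) => // lt.
  - have := m1 (lev P1 v i.+1 + u' v i - u' v i.+1).
    by rewrite -eQ m2; lia.
  - have := m1 (lev P1 v i.+1 + u' v i - u v i.+1).
    by rewrite -eQ m2; lia.
have all v : lev P v =1 lev P' v /\ u v =1 u' v.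
  have Wm : W <= maxn W v by rewrite leq_maxl.
  exact: (row_ins_backward ri ri' (emu _ Wm) (eu _ Wm)) (leq_maxr _ _).
split=> //.
  by apply: lev_inj (pt_inc pt) (pt_inc pt') _ => v i; have [-> _] := all v.
by move=> v; rewrite -uk -uk'; have [_ ->] := all v.
Qed.

Lemma hecke_inj n m (S S' : SVW n m) : hecke S = hecke S' -> S = S'.
Proof.
rewrite -!hecke_rows_all => e.
have main d : d <= n -> (hecke_rows S (n - d)).1 = (hecke_rows S' (n - d)).1 /\
    forall i c, box (hecke_rows S (n - d)).2 i c = box (hecke_rows S' (n - d)).2 i c.
  elim: d => [|d IH] dn; first by rewrite subn0 e.
  have [] := IH (ltnW dn); have kn : n - d.+1 < n by lia.
  have -> : n - d = (Ordinal kn).+1 by rewrite /=; lia.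
  by move=> e1 e2; have [] := hecke_rows_inj_step e1 e2.
apply: svw_eq_lev => i v.
have [] := main (n - i.+1) (leq_subr _ _); rewrite subKn // => e1 e2.
by have [_ _ ->] := hecke_rows_inj_step e1 e2.
Qed.

(** * Semistandard set-valued tableaux *)

Lemma all2P A B (r : A -> B -> bool) s t :
  reflect (size s = size t /\
           forall x0 y0 i, i < size s -> r (nth x0 s i) (nth y0 t i))
          (all2 r s t).
Proof.
elim: s t => [|a s IH] [|b t] /=; try by constructor; case.
  by constructor.
apply: (iffP andP) => [[ab /IH[e h]]|[[e] h]].
  by split=> [|x0 y0 [|i]] //=; [rewrite e|exact: h].
by split; [exact: (h a b 0)|apply/IH; split=> // x0 y0 i; apply: (h x0 y0 i.+1)].
Qed.

Lemma choice_ofP n (t : tableau 'I_n) (Q : svtableau n) :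
  reflect [/\ size t = size Q, forall i, rowsz t i = rowsz Q i &
              forall x0 i c, c < rowsz t i -> nth x0 (row t i) c \in box Q i c]
          (choice_of t Q).
Proof.
apply: (iffP (all2P _ _ _)) => [[e h]|[e1 e2 h]].
  have rows i : rowsz t i = rowsz Q i.
    case: (ltnP i (size t)) => it; last by rewrite !nth_default // -e.
    by have /all2P[] := h [::] [::] i it.
  split=> // x0 i c ct; case: (ltnP i (size t)) => it; last by rewrite nth_default in ct.
  by have /all2P[_] := h [::] [::] i it; apply.
split=> // x0 y0 i it; rewrite (set_nth_default [::]) // (set_nth_default [::] y0) -?e1 //.
by apply/all2P; split=> // x1 y1 c ct /=; rewrite (set_nth_default finset.set0 y1) -?e2 //; apply: h.
Qed.

Lemma choice_exists n (Q : svtableau n) (g : nat -> nat -> 'I_n) :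
  semistandard_sv Q -> (forall i c, c < rowsz Q i -> g i c \in box Q i c) ->
  (forall i c, c.+1 < rowsz Q i -> g i c <= g i c.+1) /\
  (forall i c, c < rowsz Q i.+1 -> g i c < g i.+1 c).
Proof.
case=> yd _ ch hg.
pose t := mkseq (fun i => mkseq (g i) (rowsz Q i)) (size Q).
have rt i : row t i = mkseq (g i) (rowsz Q i).
  case: (ltnP i (size Q)) => iQ; first by rewrite nth_mkseq.
  by rewrite !nth_default ?size_mkseq.
have /ch : choice_of t Q.
  apply/choice_ofP; split=> [|i|x0 i c]; rewrite ?rt ?size_mkseq //.
  by move=> ci; rewrite nth_mkseq //; apply: hg.
case/andP: yd => srt _.
move=> st; split=> i c ci.
  have /tableauP := st; move=> /(_ (g i c))[_ _ h _].
  by have := h i c; rewrite rt size_mkseq !nth_mkseq ?(ltnW ci) //; apply.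
have /tableauP := st; move=> /(_ (g i c))[_ _ _ h].
have ci2 : c < rowsz Q i by apply: leq_trans ci (sorted_geq_shape srt _).
by have := h i c; rewrite !rt size_mkseq !nth_mkseq //; apply.
Qed.

(** To compare labels of two adjacent boxes, select these two labels there and arbitrary elements in
    all other boxes; semistandardness of this selection is the required inequality. *)
Lemma semistandard_partial n (Q : svtableau n) : semistandard_sv Q -> partial_sv n Q.
Proof.
move=> sst; have [yd ne ch] := sst.
have nz i c : c < rowsz Q i -> exists l, l \in box Q i c.
  move=> ci; apply/finset.set0Pn; case: (ltnP i (size Q)) => iQ; last by rewrite nth_default in ci.
  by have /(all_nthP [::])/(_ i iQ)/(all_nthP finset.set0)/(_ c ci) := ne.
pose g (l : 'I_n) (i c i' c' : nat) (x : 'I_n) := if (i' == i) && (c' == c) then l else x.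
pose g0 (l : 'I_n) i c := odflt l [pick x in box Q i c].
have g0P l i c : c < rowsz Q i -> g0 l i c \in box Q i c.
  by move=> /nz[x xQ]; rewrite /g0; case: pickP => //= /(_ x); rewrite xQ.
split=> [i c l _|||]; rewrite ?ltn_ord //.
  move=> i c l l' lc lc'.
  have [] := choice_exists (g := fun i' c' => g l i c i' c' (g l' i c.+1 i' c' (g0 l i' c'))) sst.
    move=> i' c' /(g0P l); rewrite /g; case: andP => [[/eqP-> /eqP->]//|_].
    by case: andP => [[/eqP-> /eqP->]|].
  move=> /(_ i c (lt_rowsz_box lc')) + _; rewrite /g !eqxx /= gtn_eqF //.
move=> i c l l' lc lc'.
have [] := choice_exists (g := fun i' c' => g l i c i' c' (g l' i.+1 c i' c' (g0 l i' c'))) sst.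
  move=> i' c' /(g0P l); rewrite /g; case: andP => [[/eqP-> /eqP->]//|_].
  by case: andP => [[/eqP-> /eqP->]|].
move=> _ /(_ i c (lt_rowsz_box lc')); by rewrite /g !eqxx /= gtn_eqF.
Qed.

Lemma partial_semistandard n (Q : svtableau n) k : young_diagram (shape Q) ->
  partial_sv k Q -> semistandard_sv Q.
Proof.
move=> yd sv; have [srt n0] := andP yd.
split=> //.
  apply/(all_nthP [::]) => i iQ; apply/(all_nthP finset.set0) => c ci.
  by apply/finset.set0Pn; apply: sv_neq0 sv _ _ ci.
move=> t /choice_ofP[st rt ch].
(* ['I_n] may be empty, so the default label [x0] is taken from t itself. An empty t is
   semistandard, and an empty first row is excluded by the shape. *)
case: t st rt ch => [|[|x0 r] t] //= st rt ch.
  case: Q yd srt n0 sv st rt ch => [|q Q] // yd srt n0 sv st rt ch.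
  by move: n0; rewrite /= inE -(rt 0).
apply/(tableauP x0); have eq_shape i : rowsz ((x0 :: r) :: t) i = rowsz Q i by [].
split.
- move=> i it; rewrite eq_shape lt0n; apply: contra n0 => /eqP e.
  by rewrite -e -nth_shape mem_nth // size_map -st.
- by move=> i; rewrite !eq_shape; apply: sorted_geq_shape.
- move=> i c ci; apply: (sv_row sv (ch x0 _ _ _) (ch x0 _ _ _)) => //.
  exact: ltnW.
- move=> i c ci; apply: (sv_col sv (ch x0 _ _ _) (ch x0 _ _ _)) => //.
  by apply: leq_trans ci _; rewrite !eq_shape; apply: sorted_geq_shape.
Qed.

(** * Reconstructing a word from its two tableaux *)

Section Strips.
Context (n : nat) (Q : svtableau n).
Context (srt : sorted geq (shape Q)) (sv : partial_sv n Q).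

Definition strip_shape k i :=
  count (fun X : {set 'I_n} => [exists l : 'I_n, (l < k) && (l \in X)]) (row Q i).

(** Rows of Q increase weakly, so the boxes with a label below k form an initial segment of the row,
    and counting them gives its length. *)
Lemma strip_shapeP k i c :
  reflect (exists2 l : 'I_n, l < k & l \in box Q i c) (c < strip_shape k i).
Proof.
rewrite (prefix_count (x0 := finset.set0)); last first.
  move=> d dQ /existsP[l /andP[lk ld]]; apply/existsP.
  have [l' l'd] := sv_neq0 sv (ltnW dQ); exists l'; rewrite l'd andbT.
  exact: leq_ltn_trans (sv_row sv l'd ld) lk.
apply: (iffP andP) => [[_ /existsP[l /andP[lk ld]]]|[l lk ld]]; first by exists l.
by split; [exact: lt_rowsz_box ld|apply/existsP; exists l; rewrite lk].
Qed.

(** Detects a letter absorbed in row i: the label k shares the last box of the earlier shape with a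
    smaller label. *)
Definition strip_extra (k : 'I_n) i :=
  (0 < strip_shape k i) && (k \in box Q i (strip_shape k i).-1).

(* The values of [u] at the top level that are forced by [Q]. *)
Fixpoint strip_u (k : 'I_n) i :=
  if i is j.+1 then strip_u k j + strip_shape k.+1 j.+1 + strip_extra k j - strip_shape k j
  else strip_shape k.+1 0.

Lemma strip_shape_le k i : strip_shape k i <= strip_shape k.+1 i.
Proof.
rewrite leqNgt; apply/negP => /strip_shapeP[l lk lQ].
have : strip_shape k.+1 i < strip_shape k.+1 i; last by rewrite ltnn.
by apply/strip_shapeP; exists l => //; apply: ltnW.
Qed.

Lemma strip_shape_col k i : strip_shape k.+1 i.+1 <= strip_shape k i.
Proof.
rewrite leqNgt; apply/negP => /strip_shapeP[l lk lQ].
have : strip_shape k i < strip_shape k i; last by rewrite ltnn.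
have [l' l'Q] : exists l', l' \in box Q i (strip_shape k i).
  by apply: sv_neq0 sv _ _ _; apply: leq_trans (lt_rowsz_box lQ) (sorted_geq_shape srt _).
by apply/strip_shapeP; exists l' => //; apply: leq_trans (sv_col sv l'Q lQ) _.
Qed.

Lemma strip_extra_col (k : 'I_n) i : strip_extra k i -> strip_shape k.+1 i.+1 < strip_shape k i.
Proof.
case/andP => s0 kQ; rewrite -(prednK s0) ltnS leqNgt; apply/negP => /strip_shapeP[l lk lQ].
by have := sv_col sv kQ lQ; rewrite ltnNge -ltnS lk.
Qed.

Lemma strip_u_ge (k : 'I_n) i : strip_shape k.+1 i <= strip_u k i.
Proof.
elim: i => [|i IH] //=; have := strip_shape_le k i; lia.
Qed.

Lemma strip_hstrip (k : 'I_n) : hstrip (strip_shape k) (strip_shape k.+1) (strip_u k).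
Proof.
split=> // i; have := strip_shape_le k i; have := strip_shape_col k i.
have := @strip_extra_col k i; have := strip_u_ge k i; rewrite /=.
by case: (strip_extra k i) => /= h1 h2 h3 h4; split; lia.
Qed.

(** The interval is the one of [records], so inserting a row with these values of [u] puts the label
    k into exactly the right boxes. *)
Lemma mem_strip (k : 'I_n) i c :
  (k \in box Q i c) =
  (strip_shape k.+1 i.+1 + strip_u k i <= c + strip_u k i.+1) && (c < strip_shape k.+1 i).
Proof.
have e : (strip_shape k.+1 i.+1 + strip_u k i <= c + strip_u k i.+1) =
    (strip_shape k i <= c + strip_extra k i).
  by rewrite /=; have := strip_shape_le k i; have := strip_u_ge k i; lia.
rewrite e; apply/idP/andP => [kQ|[c1 /strip_shapeP[l lk lQ]]].
  split; last by apply/strip_shapeP; exists k.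
  rewrite leqNgt; apply/negP => lt.
  have c1 : c < strip_shape k i by lia.
  have ec : c = (strip_shape k i).-1.
    have : ~ c.+1 < strip_shape k i; last by lia.
    move=> /strip_shapeP[l lk lQ]; have := sv_row sv kQ lQ; lia.
  by move: lt; rewrite /strip_extra -ec kQ andbT; lia.
case: (leqP (strip_shape k i) c) => c2.
  have : ~ l < k; last by move=> h; suff -> : k = l by []; apply: ord_inj; lia.
  move=> lk2; move: c2; rewrite leqNgt => /negP; apply; apply/strip_shapeP.
  by exists l.
have : strip_extra k i by case: (strip_extra k i) c1 => //; lia.
move=> ex; move: c1; rewrite ex => c1; case/andP: ex => _.
by have -> : (strip_shape k i).-1 = c by lia.
Qed.

(** Rows are peeled off from the last: [row_ins_exists] turns the prescribed [la] into an earlier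
    tableau [mu] and the letters of row k - 1, and the induction continues with [mu]. The rows are
    kept as level functions [a], valid for every S that has them as its first k rows.
    [row_ins_forward] shows that the actual insertion reproduces [la]. *)
Lemma hecke_rows_surj m k la : k <= n -> strict_levels la ->
  (forall v, m < v -> la v =1 strip_shape k) -> (forall i, la 1 i = 0) ->
  exists a : nat -> nat -> nat, (forall i, [/\ a i 1 = 0,
     forall v, a i v <= a i v.+1 /\ a i v.+1 <= (a i v).+1 &
     forall v, m < v -> a i v.+1 = a i v]) /\
   forall S : SVW n m, (forall (i : 'I_n) v, i < k -> word_lev S i v = a i v) ->
     (forall v i, lev (hecke_rows S k).1 v i = la v i) /\
     (forall i c l, (l \in box (hecke_rows S k).2 i c) = (l < k) && (l \in box Q i c)).
Proof.
elim: k la => [|k IH] la kn lla top low.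
  exists (fun _ _ => 0); split=> [i|S _]; first by split.
  split=> [v i|i c l].
    rewrite /hecke_rows take0 /lev nth_nil /=; apply/esym/eqP; rewrite -leqn0.
    have z i0 : strip_shape 0 i0 = 0.
      by apply/eqP; rewrite -leqn0 leqNgt; apply/negP => /strip_shapeP[].
    have mono w d : la w i <= la (w + d) i.
      elim: d => [|d IHd]; rewrite ?addn0 // addnS; apply: leq_trans IHd _.
      by have [] := (lla.2 (w + d)).1 i.
    by apply: leq_trans (mono v m.+1) _; rewrite top ?z //; lia.
  by rewrite /hecke_rows take0 /= !nth_nil inE.
pose K := Ordinal kn.
have etop v : m < v -> la v = strip_shape k.+1 by move=> mv; apply/funext; apply: top.
have hs : hstrip (strip_shape k) (la m.+1) (strip_u K).
  by rewrite etop //; exact: (strip_hstrip K).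
have [mu [u [ri mtop utop]]] : exists mu u, [/\ row_ins mu la u,
    forall v, m < v -> mu v =1 strip_shape k & forall v, m < v -> u v =1 strip_u K].
  by apply: row_ins_exists hs => // v mv; rewrite !etop.
have [lmu _ hsv lsv] := ri.
have mlow i : mu 1 i = 0 by have [_ /(_ i)[_]] := hsv 1; rewrite low; lia.
have [a [good IHS]] := IH mu (ltnW kn) lmu mtop mlow.
exists (fun i v => if i == k then u v k else a i v); split.
  move=> i; case: eqP => _; last exact: good.
  split=> [|v|v mv]; first exact: row_ins_zero ri low _.
    exact: (lsv v).1.
  by rewrite !utop // leqW.
move=> S hS.
have hS' (i : 'I_n) v : i < k -> word_lev S i v = a i v.
  by move=> ik; rewrite hS ?(ltn_eqF ik) // ltnW.
have [h1 h2] := IHS S hS'.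
have [u' [ri' [_ _ [V mem]] uk' _ _]] := hecke_rows_insertion S K.
have [pt _ _ _] := hecke_rowsP S (ltnW kn).
have emu : lev (hecke_rows S k).1 = mu by apply/funext => v; apply/funext => i.
rewrite /= emu in ri'.
have mu0 v i : k <= i -> mu v i = 0 by rewrite -emu; apply: (pt_rows pt).
have uk v : u' v k = u v k by have := hS K v (leqnn _); rewrite /= eqxx => <-; exact: uk'.
have fwd := row_ins_forward ri' ri mu0 uk.
split=> [v i|i c l]; first by have [-> _] := fwd v.
pose W := maxn V m.+1; have VW : V <= W by rewrite leq_maxl.
have mW : m < W by rewrite leq_maxr.
have := mem W VW i c l; rewrite /= => ->.
have [el eu] := fwd W; rewrite !el !eu !utop // !top //.
case: (eqVneq l K) => [->|lK]; first by rewrite /= ltnSn mem_strip.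
rewrite h2; congr (_ && _); move: lK; rewrite -val_eqE /=; lia.
Qed.

End Strips.

Theorem theorem3p14 (n m : nat) (B : {set SVW n m}) (hB : full_subcrystal B) :
  set_bij
    [set` B]%classic
    [set PQ : tableau nat * svtableau n |
      [/\ shape PQ.1 = shape PQ.2,
          increasing PQ.1,
          exists2 S : SVW n m, S \in B & highest_weight S /\ PQ.1 = tab S &
          semistandard_sv PQ.2]]%classic
    (fun S : SVW n m => (P_hecke S, Q_hecke S)).
Proof.
have [S0 BE] := hB.
have closed S S' : S \in B -> weakly_connected S S' -> S' \in B.
  by rewrite BE !inE => h1 h2; apply: connect_trans h1 h2.
split.
- move=> S /= SB; have [S' SS' eS'] := hecke_connected S.
  rewrite /P_hecke /Q_hecke -hecke_rows_all.
  have [pt sv sQ rQ] := hecke_rowsP S (leqnn n).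
  have inc := pt_inc pt.
  have esh : shape (hecke_rows S n).1 = shape (hecke_rows S n).2.
    apply: (@eq_from_nth _ 0); rewrite !size_map // => i _.
    by rewrite !nth_shape.
  split=> //=.
    exists S'; first exact: closed SB SS'.
    have eP : tab S' = (hecke_rows S n).1 by rewrite eS' /P_hecke -hecke_rows_all.
    by split=> //; apply: increasing_tab_highest_weight; rewrite eP.
  by apply: partial_semistandard sv; rewrite -esh; case/and3P: inc.
- move=> S S' _ _ [e1 e2]; apply: hecke_inj.
  by rewrite [LHS]surjective_pairing [RHS]surjective_pairing; congr pair.
- move=> [P Q] /= [esh inc [S1 S1B [hw PE]] sst].
  have sv := semistandard_partial sst; have [yd _ _] := sst.
  have [srt _] := andP yd.
  have szE i : rowsz P i = rowsz Q i by rewrite -!nth_shape esh.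
  have levE v (i : 'I_n) : lev P v i = word_lev S1 i v by rewrite PE lev_tab.
  have lev0 v i : n <= i -> lev P v i = 0 by move=> ni; rewrite /lev PE row_tab_default.
  have hi v i : m < v -> lev P v.+1 i = lev P v i.
    move=> mv; case: (ltnP i n) => ni; last by rewrite !lev0.
    by rewrite !(levE _ (Ordinal ni)) word_lev_high.
  (* Beyond level m all entries of P are counted, and every nonempty box of Q has a label below n,
     so both sides are row lengths of the common shape. *)
  have top v : m < v -> lev P v =1 strip_shape Q n.
    move=> mv i; have [V tV] := lev_rowsz P.
    have -> : lev P v i = rowsz P i.
      rewrite -(tV (v + V)) ?leq_addl //; elim: V {tV} => [|V IH]; rewrite ?addn0 // addnS hi //; lia.
    rewrite szE /strip_shape; apply/esym/eqP; rewrite -all_count; apply/(all_nthP finset.set0) => c ci.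
    by have [l lQ] := sv_neq0 sv ci; apply/existsP; exists l; rewrite ltn_ord.
  have low i : lev P 1 i = 0.
    case: (ltnP i n) => ni; last by rewrite lev0.
    by rewrite (levE _ (Ordinal ni)) word_lev_low.
  have [a [good hS]] := hecke_rows_surj srt sv (leqnn n) (lev_strict_levels inc) top low.
  pose S := svw_of n m a.
  have [h1 h2] := hS S (fun i v _ =>
    let: And3 g1 g2 g3 := good i in word_lev_svw_of g1 g2 g3 v).
  have [pt sv' sQ rQ] := hecke_rowsP S (leqnn n).
  have eP : P_hecke S = P.
    by rewrite /P_hecke -hecke_rows_all; apply: lev_inj (pt_inc pt) inc _.
  have eQ : Q_hecke S = Q.
    rewrite /P_hecke -hecke_rows_all in eP; rewrite /Q_hecke -hecke_rows_all.
    have sz : size (hecke_rows S n).2 = size Q.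
      by rewrite sQ eP -(size_map size P) -/(shape P) esh size_map.
    apply: (@eq_from_nth _ [::]) => // i _; apply: (@eq_from_nth _ finset.set0) => [|c _].
      by rewrite rQ eP szE.
    by apply/setP => l; rewrite h2 ltn_ord.
  exists S; last by rewrite eP eQ.
  (* The element joined to S and the given highest weight element have the same tableau P.
     Injectivity of [tab] identifies them, which puts S into B. *)
  have [S' SS' eS'] := hecke_connected S.
  have e1 : S' = S1 by apply: tab_inj; rewrite eS' eP.
  by apply: closed S1B _; rewrite -e1 /weakly_connected weakly_connected_sym.
Qed.
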